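(* Let $A$ be a finite dimensional $k$-algebra with $\operatorname{rad}^2(A)=0$, and let $(\Delta_A,\mathbf{w}_A)$ be its associated quiver setting. Then $A$ has finitely many $U(A)$-orbits if and only if $(\Delta_A,\mathbf{w}_A)$ is a representation finite quiver setting. Thus $A$ has finitely many $U(A)$-orbits if and only if there is no subquiver $Q$ of $\Delta_A$ of Euclidean type such that $\mathbf{h}_Q\leq\mathbf{w}_A|_{Q_0}$.
   Context: Throughout, $k$ is an algebraically closed field, and $\mathbb{N}$ includes $0$. Algebras are associative with unit. For a $k$-algebra $A$, $U(A)$ is its group of units and $\operatorname{rad}(A)$ its Jacobson radical. A $U(A)$-orbit in $A$ is an orbit of the action of $U(A)\times U(A)$ on $A$ given by $(u,v)\ast a:=uav^{-1}$; $A$ has finitely many ($U(A)$-)orbits if there are finitely many such orbits in $A$. A quiver $Q$ consists of a finite set $Q_0$ of vertices, a finite set $Q_1$ of arrows, and maps $s,t\colon Q_1\to Q_0$ (start and terminal vertex); loops and multiple arrows are allowed. A dimension vector for $Q$ is an element $\mathbf{d}\in\mathbb{N}^{Q_0}$; inequalities are coordinatewise. A quiver setting is a pair $(Q,\mathbf{d})$ of a quiver and a dimension vector for it. A subquiver is given by subsets of vertices and arrows containing the endpoints of its arrows; it need not be full. A representation of $Q$ of dimension vector $\mathbf{d}$ is a tuple $M=(M_\alpha)_{\alpha\in Q_1}$ of $k$-linear maps $M_\alpha\colon k^{\mathbf{d}(s\alpha)}\to k^{\mathbf{d}(t\alpha)}$. Two such representations $M,N$ are isomorphic if there is a tuple $g=(g_x)_{x\in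 Q_0}$ of $k$-linear automorphisms $g_x$ of $k^{\mathbf{d}(x)}$ with $N_\alpha=g_{t\alpha}M_\alpha g_{s\alpha}^{-1}$ for every $\alpha\in Q_1$. The setting $(Q,\mathbf{d})$ is representation finite if there are only finitely many isomorphism classes of representations of $Q$ of dimension vector $\mathbf{d}$. The quiver setting $(\Delta_A,\mathbf{w}_A)$ associated with a finite dimensional $k$-algebra $A$ with $\operatorname{rad}^2(A)=0$: put $\overline{A}:=A/\operatorname{rad}(A)$. By the Wedderburn--Artin theorem $\overline{A}\simeq\mathbb{M}_{n_1}(k)\times\cdots\times\mathbb{M}_{n_l}(k)$ for positive integers $n_1,\ldots,n_l$. Let $\overline{e}_1,\ldots,\overline{e}_l$ be the (central) idempotents of $\overline{A}$ corresponding to this decomposition, $e_1,\ldots,e_l$ their lifts to $A$, and $\overline{A}_i:=\overline{e}_i\overline{A}\,\overline{e}_i\simeq\mathbb{M}_{n_i}(k)$. Since $\operatorname{rad}^2(A)=0$, $\operatorname{rad}(A)$ is an $\overline{A}$-$\overline{A}$-bimodule, and $e_i\operatorname{rad}(A)e_j$ is an $\overline{A}_i$-$\overline{A}_j$-bimodule; its rank $r_{i,j}$ is the integer such that $e_i\operatorname{rad}(A)e_j\simeq(\mathbb{M}_{n_i\times n_j}(k))^{r_{i,j}}$ as bimodules. The vertices of $\Delta_A$ are the pairs $(0,i)$ and $(1,i)$ for $1\leq i\leq l$; for all $i,j$ there are exactly $r_{i,j}$ arrows from $(1,j)$ to $(0,i)$, and there are no other arrows. The dimension vector is $\mathbf{w}_A(0,i):=n_i=:\mathbf{w}_A(1,i)$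 for $1\leq i\leq l$. A Euclidean quiver (quiver of Euclidean type) $Q$ is a quiver whose underlying graph (forget the orientation of arrows) is one of the following; the vector $\mathbf{h}_Q$ is given in each case. - $\tilde{\mathbb{A}}_n$, $n\geq 0$: a cycle with $n+1$ vertices and $n+1$ edges (for $n=0$ one vertex with one loop; for $n=1$ two vertices joined by two edges); $\mathbf{h}_Q=1$ at every vertex. - $\tilde{\mathbb{D}}_n$, $n\geq 4$ ($n+1$ vertices): a path $c_1 - \cdots - c_{n-3}$, with two further vertices attached by an edge to $c_1$ and two further vertices attached by an edge to $c_{n-3}$ (for $n=4$ all four attached to the single vertex $c_1$); $\mathbf{h}_Q=2$ at each $c_i$ and $1$ at the four further vertices. - $\tilde{\mathbb{E}}_6$: a star with a central vertex and three arms with $2$ vertices each; $\mathbf{h}_Q=3$ at the center and $2,1$ along each arm, going outward. - $\tilde{\mathbb{E}}_7$: a star with a central vertex and three arms with $3,3,1$ vertices; $\mathbf{h}_Q=4$ at the center, $3,2,1$ outward along each of the two long arms, and $2$ on the short arm. - $\tilde{\mathbb{E}}_8$: a star with a central vertex and three arms with $5,2,1$ vertices; $\mathbf{h}_Q=6$ at the center, $5,4,3,2,1$ outward along the arm with $5$ vertices, $4,2$ outward along the arm with $2$ vertices, and $3$ on the arm with $1$ vertex. *)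

(* Defs.v *)
From HB Require Import structures.
From mathcomp Require Import all_boot all_order all_algebra all_field.
From mathcomp Require Import mathcomp_extra boolp classical_sets functions.
From mathcomp Require Import cardinality.

Set Implicit Arguments.
Unset Strict Implicit.
Unset Printing Implicit Defensive.

Import GRing.Theory.
Local Open Scope classical_set_scope.
Local Open Scope ring_scope.

Definition left_ideal (R : pzRingType) (I : set R) : Prop :=
  [/\ I 0, forall x y, I x -> I y -> I (x + y) & forall a x, I x -> I (a * x)].

Definition maximal_left_ideal (R : pzRingType) (I : set R) : Prop :=
  [/\ left_ideal I, I <> setT &
      forall J, left_ideal J -> I `<=` J -> J = I \/ J = setT].

Definition jacobson_radical (R : pzRingType) : set R :=
  \bigcap_(I in @maximal_left_ideal R) I.

Definition rad_square_zero (R : pzRingType) : Prop :=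
  forall x y : R, jacobson_radical x -> jacobson_radical y -> x * y = 0.

Definition unit_orbit (R : unitRingType) (a : R) : set R :=
  [set b | exists u v, [/\ u \is a GRing.unit, v \is a GRing.unit
                         & b = u * a / v]].

Definition finitely_many_unit_orbits (R : unitRingType) : Prop :=
  finite_set [set unit_orbit a | a in [set: R]].

Record quiver := Quiver {
  vertex : finType;
  arrow : finType;
  source : arrow -> vertex;
  target : arrow -> vertex }.

Arguments source {q}.
Arguments target {q}.

Definition dimension_vector (Q : quiver) := vertex Q -> nat.

Section Representations.
Variables (k : fieldType) (Q : quiver) (d : dimension_vector Q).

(* Linear maps k^m -> k^n are n x m matrices acting on column vectors. *)
Definition representation :=
  forall a : arrow Q, 'M[k]_(d (target a), d (source a)).

Definition isomorphic (M N : representation) : Prop :=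
  exists2 g : forall x : vertex Q, 'M[k]_(d x),
    forall x, g x \in unitmx &
    forall a, N a = g (target a) *m M a *m invmx (g (source a)).

Definition isomorphism_class (M : representation) : set representation :=
  [set N | isomorphic M N].

Definition representation_finite : Prop :=
  finite_set [set isomorphism_class M | M in [set: representation]].

End Representations.

Record subquiver (Q : quiver) := Subquiver {
  sub_vertices : {set vertex Q};
  sub_arrows : {set arrow Q};
  sub_source : forall a, a \in sub_arrows -> source a \in sub_vertices;
  sub_target : forall a, a \in sub_arrows -> target a \in sub_vertices }.

Definition quiver_of_sub (Q : quiver) (S : subquiver Q) : quiver :=
  @Quiver {x : vertex Q | x \in sub_vertices S}
          {a : arrow Q | a \in sub_arrows S}
    (fun a => Sub (source (val a)) (sub_source (valP a)))
    (fun a => Sub (target (val a)) (sub_target (valP a))).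

Coercion quiver_of_sub : subquiver >-> quiver.

(* Isomorphism of underlying graphs: each edge may be traversed backwards. *)
Record graph_iso (Q Q' : quiver) := GraphIso {
  iso_vertex :> vertex Q -> vertex Q';
  iso_arrow : arrow Q -> arrow Q';
  iso_vertex_bij : bijective iso_vertex;
  iso_arrow_bij : bijective iso_arrow;
  iso_ends : forall a,
    (source (iso_arrow a), target (iso_arrow a))
      = (iso_vertex (source a), iso_vertex (target a)) \/
    (source (iso_arrow a), target (iso_arrow a))
      = (iso_vertex (target a), iso_vertex (source a)) }.

Definition cycle_quiver (n : nat) : quiver :=
  @Quiver 'I_n.+1 'I_n.+1 id (@ordS n.+1).

(* The tree on the vertices 0, ..., size ps in which vertex i.+1 is joined to
   its parent, vertex nth 0 ps i (in every use below a number at most i). *)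
Definition tree_quiver (ps : seq nat) : quiver :=
  @Quiver 'I_(size ps).+1 'I_(size ps)
    (fun i => lift ord0 i) (fun i => inord (nth 0%N ps i)).

(* EuclideanD m stands for the diagram with index m + 4. *)
Inductive euclidean_type :=
  EuclideanA of nat | EuclideanD of nat | EuclideanE6 | EuclideanE7
  | EuclideanE8.

(* In type D the path is 0, ..., m, followed by two neighbours of 0 and two of
   m.  In type E the center is 0 and the arms are listed one after the other,
   each from the center outwards. *)
Definition euclidean_diagram (T : euclidean_type) : quiver :=
  match T with
  | EuclideanA n => cycle_quiver n
  | EuclideanD m => tree_quiver (iota 0 m ++ [:: 0; 0; m; m])%N
  | EuclideanE6 => tree_quiver [:: 0; 1; 0; 3; 0; 5]%N
  | EuclideanE7 => tree_quiver [:: 0; 1; 2; 0; 4; 5; 0]%N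
  | EuclideanE8 => tree_quiver [:: 0; 1; 2; 3; 4; 0; 6; 0]%N
  end.

Definition euclidean_weight (T : euclidean_type) :
    dimension_vector (euclidean_diagram T) :=
  match T with
  | EuclideanA n => fun=> 1%N
  | EuclideanD m => fun i => if (i <= m)%N then 2%N else 1%N
  | EuclideanE6 => fun i => nth 0%N [:: 3; 2; 1; 2; 1; 2; 1]%N i
  | EuclideanE7 => fun i => nth 0%N [:: 4; 3; 2; 1; 3; 2; 1; 2]%N i
  | EuclideanE8 => fun i => nth 0%N [:: 6; 5; 4; 3; 2; 1; 4; 2; 3]%N i
  end.

(* Q is of Euclidean type and h is its vector h_Q; h does not depend on the
   chosen T and f. *)
Definition euclidean_with (Q : quiver) (h : dimension_vector Q) : Prop :=
  exists T (f : graph_iso Q (euclidean_diagram T)),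
    forall x, h x = euclidean_weight (f x).

Section AssociatedSetting.
Variables (k : fieldType) (A : falgType k).

(* The pi_i identify A / rad A with the product of the matrix algebras M_{n_i},
   in which the i-th central idempotent is the family (delta_ij)_j; e_i is a
   lift of it.  When rad^2 A = 0, an element a of A acts on the left of
   e_i (rad A) e_j through pi_i a, and on its right through pi_j a, so psi below
   is an isomorphism of bimodules from (M_{n_i x n_j})^r onto e_i (rad A) e_j. *)
Definition bimodule_rank (l : nat) (n : 'I_l -> nat)
    (pi : forall i : 'I_l, A -> 'M[k]_(n i)) (e : 'I_l -> A)
    (i j : 'I_l) (r : nat) : Prop :=
  exists psi : {linear {ffun 'I_r -> 'M[k]_(n i, n j)} -> A},
    [/\ injective psi,
        range psi = [set e i * x * e j | x in @jacobson_radical A] &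
        forall a b (X : {ffun 'I_r -> 'M[k]_(n i, n j)}),
          psi [ffun m => pi i a *m X m *m pi j b]
            = a * psi X * b].

Record wedderburn_data := WedderburnData {
  blocks : nat;
  block_size : 'I_blocks -> nat;
  block_size_gt0 : forall i, (0 < block_size i)%N;
  block_proj : forall i, {lrmorphism A -> 'M[k]_(block_size i)};
  block_proj_surj : forall X : (forall i, 'M[k]_(block_size i)),
    exists a, forall i, block_proj i a = X i;
  block_proj_ker : forall a,
    (forall i, block_proj i a = 0) <-> jacobson_radical a;
  block_idem : 'I_blocks -> A;
  block_idemP : forall i, block_idem i * block_idem i = block_idem i;
  block_idem_lift : forall i j,
    block_proj j (block_idem i) = if i == j then 1%:M else 0;
  block_rank : 'I_blocks -> 'I_blocks -> nat;
  block_rankP : forall i j,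
    bimodule_rank block_proj block_idem i j (block_rank i j) }.

Variable D : wedderburn_data.

(* The vertices (0, i) and (1, i) are (false, i) and (true, i); the arrows
   attached to the pair (i, j) go from (1, j) to (0, i). *)
Definition associated_quiver : quiver :=
  @Quiver (bool * 'I_(blocks D))%type
          {ij : 'I_(blocks D) * 'I_(blocks D) & 'I_(block_rank ij.1 ij.2)}
    (fun a => (true, (tag a).2)) (fun a => (false, (tag a).1)).

Definition associated_dimension : dimension_vector associated_quiver :=
  fun x => block_size x.2.

End AssociatedSetting.

(* Main.v *)
Require Import Defs.
From HB Require Import structures.
From mathcomp Require Import all_boot all_order all_algebra all_field.
From mathcomp Require Import mathcomp_extra boolp classical_sets functions.
From mathcomp Require Import cardinality.
From mathcomp Require Import zify ring.

(** For a dimension vector d of a quiver let q(d) be the value of the Tits form,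
    the sum of the d_x^2 minus the sum over the arrows of
    d_(source) d_(target).  Write Delta and w for the quiver setting of A.  The
    theorem is the cycle of implications

      A has finitely many orbits
      => the setting (Delta, w) is representation finite
      => no Euclidean subquiver Q of Delta has h_Q <= w
      => q(d) > 0 whenever 0 < d <= w
      => every d <= w has finitely many representations up to isomorphism
      => A has finitely many orbits.

    Orbits and representations.  As rad^2 A = 0, the radical is the direct sum
    of the bimodules e_i (rad A) e_j, and their coordinate isomorphisms turn a
    representation of dimension vector w into an element of rad A.  Units act
    through A / rad A, so two such elements lie in one orbit exactly when the
    representations are isomorphic; this gives the first implication
    (finite_orbits_representation_finite).  For the last one, any a is brought
    by units to the form c + r, where c is one of finitely many idempotents,
    whose components in A / rad A are partial identity matrices of rank p_i,
    and r lies in (1 - c) (rad A) (1 - c).  For fixed c the possible r are the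
    representations of a dimension vector d <= w, with value n_i - p_i at (0, i)
    and (1, i), and isomorphic representations give elements of one orbit
    (corner_finite).

    Euclidean subquivers.  Each of them has q(h) = 0: there are as many matrix
    entries in a base change at the vertices as in a representation of dimension
    vector h.  Since the scalars act trivially, finitely many
    isomorphism classes would cover an affine space by the images of finitely
    many polynomial maps from an affine space of smaller dimension, which is
    impossible over an infinite field (polynomial_maps_dont_cover and
    representation_finite_no_euclidean).  Extension by zero transports this from
    the subquiver to the whole quiver.

    Positivity of q.  If q(d) <= 0 for some nonzero d <= w, then a minimal such
    d has 2 d_x equal to the sum of the d_y over the neighbours y of x, for each
    x in its support.  A cycle in the support has type A.  In a forest with such
    a weight, one first finds a vertex with at least three neighbours; two of
    them, or one with four neighbours, give type D.  Otherwise the weight is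
    linear along the three arms, their lengths l, m, n (with the center counted)
    satisfy 1/l + 1/m + 1/n = 1, and a diagram of type E appears
    (no_harmonic_weight, no_euclidean_tits_positive).

    Finiteness.  Call M rigid if Ext^1(M, M) = 0.  Two rigid representations of
    the same dimension vector are isomorphic, because a rigid M is isomorphic to
    almost all points of any line through M (rigid_deform, rigid_isomorphic).
    By an argument of Ringel, positivity of q forces every indecomposable
    representation to be rigid (indecomposable_rigid).  So each dimension vector
    has at most one indecomposable representation, and the number of
    representations is bounded by the number of decompositions of the dimension
    vector (tits_positive_finite). *)

Set Implicit Arguments.
Unset Strict Implicit.
Unset Printing Implicit Defensive.

Import Order.TTheory GRing.Theory Num.Theory.
Local Open Scope classical_set_scope.
Local Open Scope ring_scope.

(** * Split images and kernels of matrices *)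

Section MatrixLemmas.
Variable k : fieldType.

Lemma split_idempotent n (e : 'M[k]_n) : e *m e = e ->
  exists r (i : 'M[k]_(n, r)) (p : 'M[k]_(r, n)), p *m i = 1%:M /\ i *m p = e.
Proof.
move=> ee; have [B BC] : exists B, B *m col_base e = 1%:M.
  exact/row_fullP/col_base_full.
move: (mulmx_base e) (row_base_free e) BC.
move: (col_base e) (row_base e) => C R CR fR BC.
exists (\rank e), C, R; split=> //; apply: (row_free_inj fR); rewrite mul1mx.
have: C *m (R *m C *m R) = C *m R by rewrite !mulmxA CR -mulmxA CR ee.
by move/(congr1 (mulmx B)); rewrite [LHS]mulmxA [RHS]mulmxA BC !mul1mx.
Qed.

(** The projection onto the kernel of A is 1 - A^+ A, where A^+ is a partial
    inverse; splitting this idempotent gives both a basis of the kernel and a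
    test for matrices that factor through A. *)
Lemma kernel_mx m n (A : 'M[k]_(m, n)) :
  exists r (i : 'M[k]_(n, r)) (l : 'M[k]_(r, n)),
  [/\ l *m i = 1%:M, A *m i = 0,
      forall p (X : 'M[k]_(n, p)), A *m X = 0 -> i *m (l *m X) = X
    & forall p (X : 'M[k]_(p, n)), X *m i = 0 -> exists Y, X = Y *m A].
Proof.
set P := pinvmx A *m A.
have AP : A *m P = A by rewrite /P mulmxA mulmxKpV.
have PP : P *m P = P by rewrite {1}/P -mulmxA AP.
have [|r [i [l [li il]]]] := @split_idempotent _ (1%:M - P).
  by rewrite mulmxBl mul1mx mulmxBr mulmx1 PP subrr subr0.
exists r, i, l; split=> // [|p X AX|p X Xi].
- by rewrite -[i]mulmx1 -li (mulmxA i) il mulmxA mulmxBr mulmx1 AP subrr mul0mx.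
- by rewrite mulmxA il mulmxBl mul1mx /P -mulmxA AX mulmx0 subr0.
- exists (X *m pinvmx A).
  have: X *m (1%:M - P) = 0 by rewrite -il mulmxA Xi mul0mx.
  by rewrite mulmxBr mulmx1 /P mulmxA => /eqP; rewrite subr_eq0 => /eqP.
Qed.

Lemma mulmx1_leq m n (i : 'M[k]_(m, n)) (p : 'M[k]_(n, m)) :
  p *m i = 1%:M -> (n <= m)%N.
Proof.
move=> pi; rewrite -[n](mxrank1 k) -pi.
exact: leq_trans (mxrankM_maxl _ _) (rank_leq_col _).
Qed.

(** A matrix B that does not lower the rank of A can be undone on A. *)
Lemma same_rank_mulmxr m n p (A : 'M[k]_(m, n)) (B : 'M[k]_(p, m)) :
  \rank (B *m A) = \rank A -> exists C, A = C *m (B *m A).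
Proof.
move=> r; apply/submxP.
by rewrite -(geq_leqif (mxrank_leqif_sup (submxMl B A))) r.
Qed.

Lemma same_rank_mulmxl m n p (A : 'M[k]_(m, n)) (B : 'M[k]_(n, p)) :
  \rank (A *m B) = \rank A -> exists C, A = (A *m B) *m C.
Proof.
move=> r; have := @same_rank_mulmxr _ _ _ A^T B^T.
rewrite -trmx_mul !mxrank_tr => /(_ r)[C eC].
by exists C^T; apply: trmx_inj; rewrite trmx_mul trmxK.
Qed.

End MatrixLemmas.

(** * Families of matrices as vectors *)

Section Vectorize.
Variables (k : pzRingType) (X : finType) (m n : X -> nat).

(** The index set of all the entries of a family of m_x by n_x matrices. *)
Definition entry := {x : X & 'I_(m x) * 'I_(n x)}%type.

Definition vectorize (f : forall x, 'M[k]_(m x, n x)) : 'rV[k]_#|{: entry}| :=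
  \row_i f (tag (enum_val i)) (tagged (enum_val i)).1 (tagged (enum_val i)).2.

Definition devectorize (v : 'rV[k]_#|{: entry}|) x : 'M[k]_(m x, n x) :=
  \matrix_(i, j) v 0 (enum_rank (Tagged (fun x => 'I_(m x) * 'I_(n x))%type (i, j))).

Lemma vectorizeK f x : devectorize (vectorize f) x = f x.
Proof. by apply/matrixP=> i j; rewrite !mxE enum_rankK. Qed.

Lemma devectorizeK : cancel devectorize vectorize.
Proof.
move=> v; apply/rowP=> i; rewrite !mxE; congr (v _ _).
by apply: enum_val_inj; rewrite enum_rankK; case: (enum_val i) => x [].
Qed.

Lemma eq_vectorize (f g : forall x, 'M[k]_(m x, n x)) :
  (forall x, f x = g x) -> vectorize f = vectorize g.
Proof. by move=> fg; apply/rowP=> i; rewrite !mxE fg. Qed.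

Lemma card_entry : #|{: entry}| = (\sum_x m x * n x)%N.
Proof.
rewrite card_tagged sumnE big_map big_enum /=.
by apply: eq_bigr => x _; rewrite card_prod !card_ord.
Qed.

End Vectorize.

(** * Deforming a kernel vector *)

(** If R is a right inverse of L0, the vector w (1 - s L1 (1 + s R L1)^-1 R) lies
    in the kernel of L0 + s L1; multiplying it by the determinant of 1 + s R L1
    makes it polynomial in s without changing its value at 0. *)
Lemma polynomial_kernel (k : fieldType) m n (L0 L1 : 'M[k]_(m, n)) (w : 'rV_m) :
  row_full L0 -> w *m L0 = 0 ->
  exists W : 'rV[{poly k}]_m, map_mx (horner_eval 0) W = w /\
    forall s, map_mx (horner_eval s) W *m (L0 + s *: L1) = 0.
Proof.
move=> /row_fullP[R RL0] wL0.
pose P p q (Z : 'M[k]_(p, q)) := map_mx polyC Z.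
have PM p q r (Y : 'M[k]_(p, q)) (Z : 'M_(q, r)) : P _ _ (Y *m Z) = P _ _ Y *m P _ _ Z.
  exact: map_mxM.
pose U := 1%:M + 'X *: P _ _ (R *m L1).
pose W := \det U *: P _ _ w - 'X *: (P _ _ (w *m L1) *m \adj U *m P _ _ R).
have evP s p q (Z : 'M[k]_(p, q)) : map_mx (horner_eval s) (P _ _ Z) = Z.
  by apply/matrixP=> i j; rewrite !mxE /horner_eval hornerC.
have evX s : horner_eval s 'X = s :> k by rewrite /horner_eval hornerX.
have WL : W *m (P _ _ L0 + 'X *: P _ _ L1) = 0.
  rewrite mulmxBl -!scalemxAl !mulmxDr -PM wL0 -scalemxAr -PM.
  rewrite -!mulmxA -PM RL0 -scalemxAr -PM.
  have -> : P n n 1%:M = 1%:M by exact: map_mx1.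
  rewrite -!mulmxDr -/U mul_adj_mx mul_mx_scalar.
  have -> : P _ _ (0 : 'rV_n) = 0 by exact: map_mx0.
  by rewrite add0r !scalerA mulrC subrr.
exists W; split=> [|s].
  rewrite /W map_mxB !map_mxZ /= evX scale0r subr0 evP -det_map_mx map_mxD map_mxZ /= evX.
  by rewrite scale0r addr0 map_mx1 det1 scale1r.
move: W WL => W /(congr1 (map_mx (horner_eval s))).
by rewrite map_mxM map_mxD map_mxZ /= evX !evP map_mx0.
Qed.

(** * Homomorphisms, extensions and rigidity *)

Section Representations.
Variables (k : fieldType) (Q : quiver).
Implicit Types d : dimension_vector Q.

Definition graded d d' := forall x : vertex Q, 'M[k]_(d' x, d x).

Definition is_hom d d' (M : representation k d) (N : representation k d')
  (f : graded d d') := forall a, N a *m f (source a) = f (target a) *m M a.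

(** Ext^1(M, N) is the cokernel of the map sending a graded linear map f to the
    family N f - f M: a family c is the off-diagonal block of an extension of M
    by N, and the extension splits when c is in the image. *)
Definition ext_vanishes d d' (M : representation k d) (N : representation k d') :=
  forall c : forall a : arrow Q, 'M[k]_(d' (target a), d (source a)),
  exists f : graded d d',
    forall a, c a = N a *m f (source a) - f (target a) *m M a.

Definition rigid d (M : representation k d) := ext_vanishes M M.

Definition total_dim d := (\sum_x d x)%N.

Definition tits_positive d :=
  (\sum_a d (target a) * d (source a) < \sum_x d x * d x)%N.

Definition tits_positive_below (D : dimension_vector Q) :=
  forall d, (forall x, d x <= D x)%N -> (0 < total_dim d)%N -> tits_positive d.

(** The map with kernel Hom(M, N) and cokernel Ext^1(M, N), in coordinates. *)
Definition coboundary_fun d d' (M : representation k d) (N : representation k d')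
    (v : 'rV[k]_#|{: entry d' d}|) :
    'rV_#|{: entry (fun a : arrow Q => d' (target a)) (fun a => d (source a))}| :=
  vectorize (fun a => N a *m devectorize v (source a) - devectorize v (target a) *m M a).

Lemma coboundary_fun_linear d d' (M : representation k d) (N : representation k d') :
  linear (coboundary_fun M N).
Proof.
move=> c u v.
have unf x (w w' : 'rV[k]_#|{: entry d' d}|) :
  devectorize (c *: w + w') x = c *: devectorize w x + devectorize w' x.
  by apply/matrixP => s t; rewrite !mxE.
apply/rowP=> i; rewrite [LHS]mxE !unf mulmxDr mulmxDl -scalemxAr -scalemxAl.
by rewrite opprD addrACA -scalerBr mxE mxE [RHS]mxE; congr (_ + _); rewrite !mxE.
Qed.

HB.instance Definition _ d d' M N :=
  GRing.isLinear.Build k _ _ _ (@coboundary_fun d d' M N)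
    (@coboundary_fun_linear d d' M N).

Definition coboundary_mx d d' (M : representation k d) (N : representation k d') :=
  lin1_mx (coboundary_fun M N).

Lemma coboundary_mxE d d' (M : representation k d) (N : representation k d')
    (f : graded d d') :
  vectorize f *m coboundary_mx M N =
  vectorize (fun a => N a *m f (source a) - f (target a) *m M a).
Proof.
rewrite mul_rV_lin1 /=; apply/rowP=> i; rewrite !mxE.
by rewrite !vectorizeK.
Qed.

Lemma vectorize_eq0 (X : finType) (m n : X -> nat) (f : forall x, 'M[k]_(m x, n x)) :
  (vectorize f = 0) <-> (forall x, f x = 0).
Proof.
split=> [f0 x|f0]; last by apply/rowP => i; rewrite !mxE f0 mxE.
by rewrite -(vectorizeK f) f0; apply/matrixP => i j; rewrite !mxE.
Qed.

Lemma hom_coboundary d d' (M : representation k d) (N : representation k d')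
    (f : graded d d') :
  is_hom M N f <-> vectorize f *m coboundary_mx M N = 0.
Proof.
rewrite coboundary_mxE vectorize_eq0; split=> h a; first by rewrite h subrr.
by apply/eqP; rewrite -subr_eq0 h.
Qed.

Lemma ext_vanishesP d d' (M : representation k d) (N : representation k d') :
  ext_vanishes M N <-> row_full (coboundary_mx M N).
Proof.
split=> [ev|/row_fullP[B BC] c].
  rewrite -sub1mx; apply/row_subP=> i; apply/submxP.
  have [f hf] := ev (devectorize (row i 1%:M)).
  exists (vectorize f); rewrite coboundary_mxE -[LHS]devectorizeK.
  exact: eq_vectorize.
exists (devectorize (vectorize c *m B)) => a.
have := mulmx1 (vectorize c); rewrite -BC mulmxA -{1}[_ *m B]devectorizeK coboundary_mxE.
by move/(congr1 (@devectorize _ _ _ _ ^~ a)); rewrite !vectorizeK => <-.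
Qed.

(** By the rank formula, dim End(M) - dim Ext^1(M, M) is the value of the Tits
    form; it is positive and dim End(M) = 1. *)
Lemma brick_rigid d (M : representation k d) :
  tits_positive d ->
  (forall f : graded d d, is_hom M M f -> exists c, forall x, f x = c%:M) ->
  rigid M.
Proof.
move=> q brick; apply/ext_vanishesP.
rewrite /row_full eqn_leq rank_leq_col /=.
have: (\rank (kermx (coboundary_mx M M)) <= 1)%N.
  apply: leq_trans (rank_leq_row (vectorize (fun x => 1%:M : 'M[k]_(d x)))).
  apply: mxrankS; apply/row_subP=> i.
  have /eqP := mulmx_ker (coboundary_mx M M).
  move=> /eqP /row_matrixP/(_ i); rewrite row_mul row0.
  rewrite -{1}[row i _]devectorizeK => /hom_coboundary/brick[c hc].
  apply/submxP; exists c%:M; rewrite -[LHS]devectorizeK mul_scalar_mx.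
  by apply/rowP=> j; rewrite [LHS]mxE hc !mxE mulr_natr.
rewrite mxrank_ker leq_subLR => h.
rewrite -(leq_add2r 1); apply: leq_trans h.
by rewrite !card_entry addn1.
Qed.

(** Rigidity says that the coboundary matrix L0 of M into itself is onto.  The
    homomorphisms from M to M + s (N - M) are the kernel of L0 + s L1 with a
    suitable L1, so the identity of M deforms into a homomorphism depending
    polynomially on s, and p is the product of its determinants. *)
Lemma rigid_deform d (M N : representation k d) : rigid M ->
  exists2 p : {poly k}, p.[0] != 0 & forall s, p.[s] != 0 ->
    isomorphic M (fun a => M a + s *: (N a - M a)).
Proof.
move=> /ext_vanishesP fullM.
pose Z : representation k d := fun=> 0.
pose C : representation k d := fun a => N a - M a.
have id0 : vectorize (fun x => 1%:M : 'M[k]_(d x)) *m coboundary_mx M M = 0.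
  by apply/hom_coboundary => a; rewrite mulmx1 mul1mx.
have [W [W0 Ws]] := polynomial_kernel (coboundary_mx Z C) fullM id0.
have evW s x : map_mx (horner_eval s) (devectorize W x)
    = devectorize (map_mx (horner_eval s) W) x.
  by apply/matrixP => i j; rewrite !mxE.
exists (\prod_x \det (devectorize W x)) => [|s ps].
  rewrite horner_prod prodf_seq_neq0; apply/allP=> x _ /=.
  by rewrite -/(horner_eval 0 _) -det_map_mx evW W0 vectorizeK det1 oner_neq0.
pose g x := devectorize (map_mx (horner_eval s) W) x : 'M[k]_(d x).
have gu x : g x \in unitmx.
  rewrite unitmxE unitfE /g -evW det_map_mx.
  move: ps; rewrite horner_prod prodf_seq_neq0 => /allP/(_ x (mem_index_enum x)).
  exact.
exists g => // a; apply: (can_inj (mulmxK (gu (source a)))); rewrite mulmxKV //.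
have := Ws s; rewrite mulmxDr -scalemxAr -[map_mx _ W]devectorizeK !coboundary_mxE.
move=> /(congr1 (@devectorize _ _ _ _ ^~ a)) e.
have {e} : (M a *m g (source a) - g (target a) *m M a) + s *: (C a *m g (source a)) = 0.
  apply/matrixP=> i j; move/matrixP/(_ i j): e; rewrite !mxE !enum_rankK /=.
  rewrite [X in _ + s * (_ - X)]big1 ?subr0 // => j0 _.
  by rewrite [Z _ _ _]mxE mulr0.
by move=> e; apply/eqP; rewrite mulmxDl -scalemxAl -subr_eq0 addrAC e.
Qed.

End Representations.

Lemma minimal_by (T : Type) (P : T -> Prop) (f : T -> nat) :
  (exists x, P x) -> exists2 x, P x & forall y, P y -> (f x <= f y)%N.
Proof.
case=> x Px; have [n] := ubnP (f x); elim: n x Px => // n IH x Px /ltnSE fx.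
have [[y Py fy]|h] := pselect (exists2 y, P y & (f y < f x)%N).
  by apply: (IH y Py); apply: leq_trans fy fx.
by exists x => // y Py; rewrite leqNgt; apply/negP => ?; apply: h; exists y.
Qed.

Lemma dependent_choice_fun (T : Type) (S : T -> Type) (P : forall x, S x -> Prop) :
  (forall x, exists y, P x y) -> exists f : forall x, S x, forall x, P x (f x).
Proof. by move=> h; exists (fun x => sval (cid (h x))) => x; apply: svalP. Qed.

(** * Isomorphic and rigid representations *)

Section Isomorphic.
Variables (k : fieldType) (Q : quiver) (d : dimension_vector Q).
Implicit Types M N L : representation k d.

Lemma isomorphic_sym M N : isomorphic M N -> isomorphic N M.
Proof.
case=> g gu gE; exists (fun x => invmx (g x)) => [x|a]; first by rewrite unitmx_inv.
by rewrite gE invmxK !mulmxA mulVmx // mul1mx -mulmxA mulVmx // mulmx1.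
Qed.

Lemma isomorphicP M N :
  isomorphic M N <-> exists g h : forall x, 'M[k]_(d x),
    (forall x, g x *m h x = 1%:M) /\ forall a, N a *m g (source a) = g (target a) *m M a.
Proof.
split=> [[g gu gE]|[g [h [gh gE]]]].
  exists g, (fun x => invmx (g x)); split=> [x|a]; first by rewrite mulmxV.
  by rewrite gE mulmxKV.
have gu x : g x \in unitmx by have [] := mulmx1_unit (gh x).
by exists g => // a; rewrite -gE mulmxK.
Qed.

Lemma isomorphic_trans M N L : isomorphic M N -> isomorphic N L -> isomorphic M L.
Proof.
move=> /isomorphicP[g [g' [gg' gE]]] /isomorphicP[h [h' [hh' hE]]].
apply/isomorphicP; exists (fun x => h x *m g x), (fun x => g' x *m h' x).
split=> [x|a]; first by rewrite mulmxA -(mulmxA (h x)) gg' mulmx1.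
by rewrite mulmxA hE -mulmxA gE mulmxA.
Qed.

End Isomorphic.

(** Almost all points of the line through M and N are isomorphic to M, and
    almost all are isomorphic to N. *)
Lemma rigid_isomorphic (k : closedFieldType) (Q : quiver) (d : dimension_vector Q)
    (M N : representation k d) : rigid M -> rigid N -> isomorphic M N.
Proof.
move=> /(@rigid_deform _ _ _ M N)[p p0 hp] /(@rigid_deform _ _ _ N M)[q q0 hq].
have /closed_nonrootP[s] : p * (q \Po (1 - 'X)) != 0.
  apply: contraNneq p0 => /eqP; rewrite mulf_eq0 => /orP[/eqP->|/eqP e].
    by rewrite horner0.
  have := congr1 (horner^~ 1) e; rewrite horner_comp !hornerE subrr => /eqP.
  by rewrite (negPf q0).
rewrite /root hornerM horner_comp !hornerE mulf_eq0 negb_or => /andP[ps qs].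
apply: isomorphic_trans (hp s ps) _; apply: isomorphic_sym.
have [g gu gE] := hq _ qs; exists g => // a; rewrite -gE.
apply/matrixP=> i j; rewrite !mxE mulrBl mul1r.
by rewrite addrA subrKC -mulrN opprB.
Qed.

(** * Retracts *)

Section Retracts.
Variables (k : closedFieldType) (Q : quiver).
Implicit Types d : dimension_vector Q.

(** A decomposition into two summands is the same as an idempotent
    endomorphism; in this form the dimension vector of the summands does not
    appear. The zero representation counts as indecomposable. *)
Definition indecomposable d (M : representation k d) :=
  forall e : graded k d d, is_hom M M e -> (forall x, e x *m e x = e x) ->
  (forall x, e x = 0) \/ (forall x, e x = 1%:M).

Lemma is_hom_comp d1 d2 d3 (M : representation k d1) (N : representation k d2)
    (L : representation k d3) (g : graded k d2 d3) (f : graded k d1 d2) :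
  is_hom N L g -> is_hom M N f -> is_hom M L (fun x => g x *m f x).
Proof. by move=> hg hf a; rewrite mulmxA hg -mulmxA hf mulmxA. Qed.

Lemma idempotent_split d (M : representation k d) (e : graded k d d) :
  is_hom M M e -> (forall x, e x *m e x = e x) ->
  exists (d' : dimension_vector Q) (K : representation k d')
    (i : graded k d' d) (p : graded k d d'),
  [/\ is_hom K M i, is_hom M K p, forall x, p x *m i x = 1%:M
    & forall x, i x *m p x = e x].
Proof.
move=> he ee.
have /dependent_choice_fun[F FP] x :
    exists F : {r & 'M[k]_(d x, r) * 'M[k]_(r, d x)}%type,
    (tagged F).2 *m (tagged F).1 = 1%:M /\ (tagged F).1 *m (tagged F).2 = e x.
  have [r [i [p pi]]] := split_idempotent (ee x).
  by exists (existT _ r (i, p)).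
pose i : graded k (fun x => tag (F x)) d := fun x => (tagged (F x)).1.
pose p : graded k d (fun x => tag (F x)) := fun x => (tagged (F x)).2.
have pi x : p x *m i x = 1%:M by have [] := FP x.
have ip x : i x *m p x = e x by have [] := FP x.
exists (fun x => tag (F x)), (fun a => p (target a) *m M a *m i (source a)), i, p.
split=> // a.
  rewrite -[i (source a)]mulmx1 -(pi (source a)) 2![in LHS]mulmxA.
  rewrite -(mulmxA (M a)) ip he -ip -!mulmxA; congr (_ *m (_ *m (_ *m _))).
  by rewrite pi mulmx1.
by rewrite -mulmxA ip -mulmxA he -ip !mulmxA pi mul1mx.
Qed.

Lemma kernel_rep d d' (M : representation k d) (N : representation k d')
    (f : graded k d d') : is_hom M N f ->
  exists (dK : dimension_vector Q) (K : representation k dK)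
    (i : graded k dK d) (l : graded k d dK),
  [/\ is_hom K M i, forall x, l x *m i x = 1%:M, forall x, f x *m i x = 0,
      forall x p (X : 'M[k]_(d x, p)), f x *m X = 0 -> i x *m (l x *m X) = X
    & forall x p (X : 'M[k]_(p, d x)), X *m i x = 0 -> exists Y, X = Y *m f x].
Proof.
move=> hf.
have /dependent_choice_fun[F FP] x :
    exists F : {r & 'M[k]_(d x, r) * 'M[k]_(r, d x)}%type,
    [/\ (tagged F).2 *m (tagged F).1 = 1%:M, f x *m (tagged F).1 = 0,
     forall p (X : 'M[k]_(d x, p)),
       f x *m X = 0 -> (tagged F).1 *m ((tagged F).2 *m X) = X
     & forall p (X : 'M[k]_(p, d x)), X *m (tagged F).1 = 0 -> exists Y, X = Y *m f x].
  have [r [i [l h]]] := kernel_mx (f x).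
  by exists (existT _ r (i, l)).
exists (fun x => tag (F x)).
exists (fun a => (tagged (F (target a))).2 *m M a *m (tagged (F (source a))).1).
exists (fun x => (tagged (F x)).1), (fun x => (tagged (F x)).2).
split=> [a|x|x|x|x]; try by have [] := FP x.
have [_ _ fact _] := FP (target a); rewrite -[in RHS]mulmxA fact //.
by rewrite mulmxA -hf -mulmxA; have [_ -> _ _] := FP (source a); rewrite mulmx0.
Qed.

(** A nonzero retract of an indecomposable representation is everything. *)
Lemma retract_nontrivial d d' (M : representation k d) (K : representation k d')
    (i : graded k d' d) (p : graded k d d') :
  indecomposable M -> is_hom K M i -> is_hom M K p ->
  (forall x, p x *m i x = 1%:M) -> (0 < total_dim d')%N -> total_dim d = total_dim d'.
Proof.
move=> indM hi hp pi d'0.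
have le x : (d' x <= d x)%N by exact: mulmx1_leq (pi x).
have [x|e0|e1] := indM _ (is_hom_comp hi hp).
- by rewrite -!mulmxA (mulmxA (p x)) pi mul1mx.
- have [x /negP[]] : exists x, d' x != 0%N.
    apply/existsP; apply: contraLR d'0; rewrite negb_exists => /forallP h.
    rewrite -leqNgt leqn0 /total_dim sum_nat_eq0; apply/forallP=> x.
    exact: negbNE (h x).
  rewrite -leqn0 -{1}(mxrank1 k (d' x)) -(pi x) -[p x]mul1mx -(pi x) -!mulmxA.
  by rewrite (mulmxA (i x)) e0 mul0mx mulmx0 mxrank0.
- apply: eq_bigr => x _; apply/eqP; rewrite eqn_leq le andbT.
  exact: mulmx1_leq (e1 x).
Qed.

(** A retract of minimal dimension among those whose projection does not kill f
    is indecomposable. *)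
Lemma rigid_retract (D : dimension_vector Q) d p (M : representation k d)
    (f : forall x, 'M[k]_(d x, p x)) :
  (forall x, (d x <= D x)%N) ->
  (forall d' (K : representation k d'), (forall x, (d' x <= D x)%N) ->
     (0 < total_dim d' <= total_dim d)%N -> indecomposable K -> rigid K) ->
  (exists x, f x <> 0) ->
  exists d' (K : representation k d') (i : graded k d' d) (r : graded k d d'),
  [/\ rigid K, is_hom K M i, is_hom M K r, forall x, r x *m i x = 1%:M
    & exists x, r x *m f x <> 0].
Proof.
move=> dD IH fn0.
pose P (d' : dimension_vector Q) :=
  exists (K : representation k d') (i : graded k d' d) (r : graded k d d'),
  [/\ is_hom K M i, is_hom M K r, forall x, r x *m i x = 1%:M
    & exists x, r x *m f x <> 0].
have [|d' [K [i [r [hi hr ri [x0 rf]]]]] dmin] := @minimal_by _ P (@total_dim Q).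
  exists d, M, (fun=> 1%:M), (fun=> 1%:M); split.
  - by move=> a; rewrite mulmx1 mul1mx.
  - by move=> a; rewrite mulmx1 mul1mx.
  - by move=> x; rewrite mulmx1.
  - by case: fn0 => x ?; exists x; rewrite mul1mx.
have le x : (d' x <= d x)%N by exact: mulmx1_leq (ri x).
exists d', K, i, r; split=> //; last by exists x0.
apply: IH => [x||e he ee]; first exact: leq_trans (le x) (dD x).
  rewrite leq_sum ?andbT //; rewrite lt0n; apply/negP=> d0.
  apply: rf; apply/eqP; rewrite -mxrank_eq0 -leqn0.
  apply: leq_trans (rank_leq_row _) _.
  by move: d0; rewrite /total_dim sum_nat_eq0 => /forallP/(_ x0)/eqP->.
(* The images of e and of 1 - e are again retracts of M, and one of them still
   sees f; by minimality it has the same dimension as K. *)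
have minimal (g : graded k d' d') : is_hom K K g -> (forall x, g x *m g x = g x) ->
    (exists x, g x *m (r x *m f x) <> 0) -> forall x, g x = 1%:M.
  move=> hg gg [x1 grf].
  have [d2 [L [j [q [hj hq qj jq]]]]] := idempotent_split hg gg.
  have le2 x : (d2 x <= d' x)%N by exact: mulmx1_leq (qj x).
  have : (total_dim d' <= total_dim d2)%N.
    apply: dmin; exists L, (fun x => i x *m j x), (fun x => q x *m r x); split.
    - exact: is_hom_comp hi hj.
    - exact: is_hom_comp hq hr.
    - by move=> x; rewrite -mulmxA (mulmxA (r x)) ri mul1mx.
    - exists x1 => z; apply: grf.
      by rewrite -jq -mulmxA (mulmxA (q x1)) z mulmx0.
  move=> tot x.
  have e2 : d2 x = d' x.
    have := (leqif_sum (fun x (_ : true) => leqif_eq (le2 x))).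
    move=> /= /leqifP; case: ifP => [/forallP/(_ x)/eqP//|_].
    by rewrite ltnNge => /negP[].
  have gu : g x \in unitmx.
    have : (\rank (1%:M : 'M[k]_(d2 x)) <= \rank (g x))%N.
      have <- : q x *m g x *m j x = 1%:M by rewrite -jq !mulmxA qj mul1mx qj.
      exact: leq_trans (mxrankM_maxl _ _) (mxrankM_maxr _ _).
    by rewrite mxrank1 e2 -row_full_unit /row_full eqn_leq rank_leq_row.
  by rewrite -[LHS]mulmx1 -(mulmxV gu) mulmxA gg.
have [ne|e0] := pselect (exists x, e x *m (r x *m f x) <> 0).
  by right; apply: minimal.
left.
have e1 : forall x, 1%:M - e x = 1%:M.
  apply: minimal.
  - by move=> a; rewrite mulmxBr mulmxBl mulmx1 mul1mx he.
  - by move=> x; rewrite mulmxBr mulmx1 mulmxBl mul1mx ee subrr subr0.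
  - exists x0; rewrite mulmxBl mul1mx; apply: contra_not rf => <-.
    have -> : e x0 *m (r x0 *m f x0) = 0; last by rewrite subr0.
    by apply: contrapT => h; apply: e0; exists x0.
by move=> x; apply/eqP; rewrite -oppr_eq0 -(addKr 1%:M (- e x)) e1 addNr.
Qed.

End Retracts.

(** * Indecomposable representations are rigid *)

Section Indecomposables.
Variables (k : closedFieldType) (Q : quiver).
Implicit Types d : dimension_vector Q.

(** If f and f * f have equal rank then the space is the direct sum of the image
    and the kernel of f, and the projection e onto the image is an
    endomorphism. *)
Lemma square_zero_or_split d (M : representation k d) (f : graded k d d) :
  indecomposable M -> is_hom M M f ->
  (forall x, \rank (f x *m f x) = \rank (f x)) ->
  (forall x, f x = 0) \/ (forall x, f x \in unitmx).
Proof.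
move=> indM hf rf.
have /dependent_choice_fun[c cE] x := same_rank_mulmxr (rf x).
have [dK [K [i [l [hi li fi _ kill]]]]] := kernel_rep hf.
have [e [eE ef ei]] : exists e : graded k d d, [/\ forall x, e x = c x *m f x,
    forall x, e x *m f x = f x & forall x, e x *m i x = 0].
  exists (fun x => c x *m f x).
  by split=> x; [|rewrite -mulmxA -cE|rewrite -mulmxA fi mulmx0].
(* The columns of f and of i span, because f and f * f have the same rank. *)
have span x p (X : 'M[k]_(p, d x)) : X *m f x = 0 -> X *m i x = 0 -> X = 0.
  move=> Xf /kill[Y XY]; have [c' cE'] := same_rank_mulmxl (rf x).
  by rewrite XY cE' !mulmxA -XY Xf mul0mx.
have he : is_hom M M e.
  move=> a; apply/eqP; rewrite -subr_eq0; apply/eqP; apply: span.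
    by rewrite mulmxBl -!mulmxA ef hf mulmxA ef -hf subrr.
  by rewrite mulmxBl -!mulmxA ei hi mulmxA ei mul0mx mulmx0 subrr.
have ee x : e x *m e x = e x.
  apply/eqP; rewrite -subr_eq0; apply/eqP; apply: span.
    by rewrite mulmxBl -mulmxA !ef subrr.
  by rewrite mulmxBl -mulmxA ei mulmx0 subrr.
have [e0|e1] := indM e he ee; [left|right] => x; first by rewrite -ef e0 mul0mx.
by have := e1 x; rewrite eE => /mulmx1_unit[].
Qed.

(** Subtract an eigenvalue of one of the components. *)
Lemma nonscalar_endomorphism d (M : representation k d) (f : graded k d d) :
  (0 < total_dim d)%N -> is_hom M M f ->
  ~ (exists c, forall x, f x = c%:M) ->
  exists2 g : graded k d d, is_hom M M g &
    (exists x, g x <> 0) /\ (exists x, g x \notin unitmx).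
Proof.
move=> d0 hf nf.
have [x dx] : exists x, d x != 0%N.
  apply/existsP; apply: contraLR d0; rewrite negb_exists => /forallP h.
  rewrite -leqNgt leqn0 /total_dim sum_nat_eq0; apply/forallP=> x.
  exact: negbNE (h x).
have /closed_rootP[c] : size (char_poly (f x)) != 1%N.
  by rewrite size_char_poly eqSS.
rewrite -eigenvalue_root_char => fc.
exists (fun y => f y - c%:M).
  by move=> a; rewrite mulmxBr mulmxBl mul_mx_scalar mul_scalar_mx hf.
split; last first.
  exists x; rewrite -row_free_unit -kermx_eq0; exact: fc.
apply: contrapT => h; apply: nf; exists c => y; apply/eqP; rewrite -subr_eq0.
by apply/eqP; apply: contrapT => n0; apply: h; exists y.
Qed.

(** Ringel's argument, by induction on the dimension.  If all endomorphisms of M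
    are scalars, M is rigid by positivity of the Tits form.  Otherwise let f be
    a nonzero noninvertible endomorphism of minimal rank; its square is zero, so
    its image lies in its kernel K.  Choose a rigid retract R of K on which f is
    not zero.  The composite of f with the projection r to R has, by minimality,
    the same kernel as f.  As Ext^1(R, R) = 0, the projection r then extends from
    K to M, so that R is a proper nonzero retract of M. *)
Theorem indecomposable_rigid (D : dimension_vector Q) :
  tits_positive_below D ->
  forall d (M : representation k d), (forall x, d x <= D x)%N ->
  (0 < total_dim d)%N -> indecomposable M -> rigid M.
Proof.
move=> pos d M; have [n] := ubnP (total_dim d).
elim: n d M => // n IH d M /ltnSE dn dD d0 indM.
have [brick|/existsNP[f0 /not_implyP[hf0 nf0]]] :=
  pselect (forall f : graded k d d, is_hom M M f -> exists c, forall x, f x = c%:M).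
  by apply: brick_rigid => //; apply: pos.
pose rk (f : graded k d d) := (\sum_x \rank (f x))%N.
pose P (f : graded k d d) :=
  [/\ is_hom M M f, exists x, f x <> 0 & exists x, f x \notin unitmx].
have [|f [hf [x0 fx0] [x1 fx1]] fmin] := @minimal_by _ P rk.
  by have [g hg [g0 gu]] := nonscalar_endomorphism d0 hf0 nf0; exists g.
have rank_min (g : graded k d d) : is_hom M M g -> (exists x, g x <> 0) ->
    (forall x, \rank (g x) <= \rank (f x))%N -> forall x, \rank (g x) = \rank (f x).
  move=> hg g0 le x.
  have := leqif_sum (fun x (_ : true) => leqif_eq (le x)).
  move=> /= /leqifP; case: ifP => [/forallP/(_ x)/eqP//|_].
  rewrite ltnNge => /negP[]; apply: fmin; split=> //; exists x1.
  rewrite -row_free_unit /row_free; apply: contra fx1 => /eqP gx1.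
  by rewrite -row_free_unit /row_free eqn_leq rank_leq_row -{1}gx1 le.
have [ff|/existsNP ff] := pselect (forall x, f x *m f x = 0); last first.
  have [|fz|fu] := square_zero_or_split indM hf.
  - apply: (rank_min (fun x => f x *m f x)) => // [|x]; first exact: (is_hom_comp hf hf).
    exact: mxrankM_maxr.
  - by case: fx0.
  - by rewrite fu in fx1.
have [dK [K [i [l [hi li fi fact kill]]]]] := kernel_rep hf.
have le x : (dK x <= d x)%N by exact: mulmx1_leq (li x).
have ilf x : i x *m (l x *m f x) = f x by apply: fact.
have ltK : (total_dim dK < total_dim d)%N.
  rewrite ltn_neqAle leq_sum ?andbT //; apply/eqP => e; apply: fx0.
  have e0 : dK x0 = d x0.
    have := leqif_sum (fun x (_ : true) => leqif_eq (le x)).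
    by move=> /= [_]; rewrite -/(total_dim dK) e eqxx => /esym/forallP/(_ x0)/eqP.
  have : row_free (i x0).
    have : (\rank (1%:M : 'M[k]_(dK x0)) <= \rank (i x0))%N.
      by rewrite -(li x0) mxrankM_maxr.
    rewrite mxrank1 /row_free eqn_leq rank_leq_row => h.
    by apply: leq_trans h; rewrite e0.
  by move/row_free_inj => inj; apply: inj; rewrite fi mul0mx.
have dKD x : (dK x <= D x)%N by exact: leq_trans (le x) (dD x).
have [||dR [R [j [r [rigR hj hr rj [x2 rlf]]]]]] :=
  rigid_retract K (f := fun x => l x *m f x) dKD.
- move=> d' L d'D /andP[d'0 d'K] indL; apply: IH => //.
  by apply: leq_trans dn; apply: leq_ltn_trans d'K ltK.
- by exists x0 => lf0; apply: fx0; rewrite -ilf lf0 mulmx0.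
have hlf : is_hom M K (fun x => l x *m f x).
  move=> a; rewrite -[LHS]mul1mx -(li (target a)) -mulmxA.
  by rewrite (mulmxA (i _)) -hi -mulmxA ilf hf mulmxA.
pose b x := r x *m (l x *m f x).
have hb : is_hom M R b by exact: is_hom_comp hr hlf.
have bE x : i x *m (j x *m (r x *m l x)) *m f x = i x *m (j x *m b x).
  by rewrite /b !mulmxA.
have fb x : exists C, f x = C *m b x.
  have [|C ->] := @same_rank_mulmxr _ _ _ _ (f x) (i x *m (j x *m (r x *m l x))).
    move: x; apply: rank_min => [a||x]; last exact: mxrankM_maxr.
      by rewrite !bE; exact: (is_hom_comp hi (is_hom_comp hj hb) a).
    exists x2; rewrite bE => z; apply: rlf.
    rewrite -[LHS]mul1mx -(rj x2) -mulmxA -[X in r x2 *m X]mul1mx -(li x2).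
    by rewrite -!mulmxA z !mulmx0.
  by exists (C *m i x *m j x); rewrite bE !mulmxA.
have bi x : b x *m i x = 0 by rewrite /b -!mulmxA fi !mulmx0.
clearbody b.
(* The defect of the extension r * l of r to M vanishes on ker f = ker b, so it
   is a cochain on R composed with b, and the rigidity of R corrects it. *)
have /dependent_choice_fun[c cE] a : exists Z,
    R a *m (r (source a) *m l (source a)) - (r (target a) *m l (target a)) *m M a
      = Z *m b (source a).
  have [|Y ->] := kill (source a) _ (R a *m (r (source a) *m l (source a))
      - (r (target a) *m l (target a)) *m M a).
    rewrite mulmxBl -!mulmxA li mulmx1 hi (mulmxA (l _)) li mul1mx.
    by rewrite hr subrr.
  by have [C ->] := fb (source a); exists (Y *m C); rewrite mulmxA.
have [g gE] := rigR c.
pose s x := r x *m l x - g x *m b x.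
have hs : is_hom M R s.
  move=> a; have := cE a => /eqP; rewrite subr_eq => /eqP E.
  rewrite /s mulmxBr E gE [in RHS]mulmxBl mulmxBl -(mulmxA (R a)) -(mulmxA (g _)) hb.
  by rewrite (mulmxA (g (target a))) addrAC [X in X + _ = _]addrAC subrr add0r addrC.
have sij x : s x *m (i x *m j x) = 1%:M.
  rewrite /s mulmxBl -!mulmxA (mulmxA (l x)) li mul1mx rj.
  by rewrite (mulmxA (b x)) bi mul0mx mulmx0 subr0.
have R0 : (0 < total_dim dR)%N.
  rewrite lt0n; apply/negP=> h; apply: rlf; apply/eqP; rewrite -mxrank_eq0 -leqn0.
  apply: leq_trans (rank_leq_row _) _.
  by move: h; rewrite /total_dim sum_nat_eq0 => /forallP/(_ x2)/eqP->.
have e := retract_nontrivial indM (is_hom_comp hi hj) hs sij R0.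
have : (total_dim dR <= total_dim dK)%N.
  by apply: leq_sum => x _; exact: mulmx1_leq (rj x).
by rewrite -e leqNgt ltK.
Qed.

End Indecomposables.

(** * Finiteness from positivity of the Tits form *)

Section Finiteness.
Variables (k : closedFieldType) (Q : quiver).
Implicit Types d : dimension_vector Q.

Definition finitely_represented d (P : representation k d -> Prop) :=
  exists2 S : set (representation k d), finite_set S &
    forall M, P M -> exists2 N, S N & isomorphic N M.

(** The maps i1, i2 and p1, p2 are the inclusions and projections of a direct
    sum decomposition of M into K1 and K2. *)
Definition decomposes_as d1 d2 d (M : representation k d) :=
  exists (K1 : representation k d1) (K2 : representation k d2)
    (i1 : graded k d1 d) (p1 : graded k d d1) (i2 : graded k d2 d) (p2 : graded k d d2),
  [/\ forall x, p1 x *m i1 x = 1%:M, forall x, p2 x *m i2 x = 1%:M,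
      forall x, i1 x *m p1 x + i2 x *m p2 x = 1%:M
    & forall a, M a = i1 (target a) *m K1 a *m p1 (source a)
                      + i2 (target a) *m K2 a *m p2 (source a)].

Lemma projection_orth n n1 n2 (i1 : 'M[k]_(n, n1)) (p1 : 'M_(n1, n))
    (i2 : 'M_(n, n2)) (p2 : 'M_(n2, n)) :
  p1 *m i1 = 1%:M -> p2 *m i2 = 1%:M -> i1 *m p1 + i2 *m p2 = 1%:M ->
  p1 *m i2 = 0.
Proof.
move=> e1 e2 e; rewrite -[p1 *m i2]mulmx1 -e2 mulmxA -(mulmxA p1).
have -> : i2 *m p2 = 1%:M - i1 *m p1 by rewrite -e addrC addKr.
by rewrite mulmxBr mulmx1 mulmxA e1 mul1mx subrr mul0mx.
Qed.

Lemma mul_blocks m n p n1 n2 m1 m2 p1 p2 (i1 : 'M[k]_(m, m1)) (i2 : 'M_(m, m2))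
    (q1 : 'M_(n1, n)) (q2 : 'M_(n2, n)) (j1 : 'M_(n, n1)) (j2 : 'M_(n, n2))
    (r1 : 'M_(p1, p)) (r2 : 'M_(p2, p)) A1 A2 B1 B2 :
  q1 *m j1 = 1%:M -> q2 *m j2 = 1%:M -> j1 *m q1 + j2 *m q2 = 1%:M ->
  (i1 *m A1 *m q1 + i2 *m A2 *m q2) *m (j1 *m B1 *m r1 + j2 *m B2 *m r2) =
  i1 *m (A1 *m B1) *m r1 + i2 *m (A2 *m B2) *m r2.
Proof.
move=> e1 e2 e; have o1 := projection_orth e1 e2 e.
have o2 : q2 *m j1 = 0 by apply: (projection_orth e2 e1); rewrite addrC.
rewrite mulmxDl !mulmxDr -!mulmxA (mulmxA q1 j1) (mulmxA q1 j2) (mulmxA q2 j1).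
by rewrite (mulmxA q2 j2) e1 e2 o1 o2 !mul1mx !mul0mx !mulmx0 addr0 add0r.
Qed.

(** Fixing one direct sum decomposition of the underlying spaces, the direct sum
    depends only on the isomorphism classes of the summands. *)
Lemma decomposes_finite d1 d2 d :
  finitely_represented (fun M : representation k d1 => True) ->
  finitely_represented (fun M : representation k d2 => True) ->
  finitely_represented (@decomposes_as d1 d2 d).
Proof.
move=> [S1 fS1 h1] [S2 fS2 h2].
have [[M0 [_ [_ [j1 [q1 [j2 [q2 [qj1 qj2 jq _]]]]]]]]|no] :=
  pselect (exists M : representation k d, decomposes_as d1 d2 M); last first.
  by exists set0 => // M hM; case: no; exists M.
pose sum (L1 : representation k d1) (L2 : representation k d2) : representation k d :=
  fun a => j1 (target a) *m L1 a *m q1 (source a)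
           + j2 (target a) *m L2 a *m q2 (source a).
exists (image2 S1 S2 sum); first exact: finite_image2.
move=> M [K1 [K2 [i1 [p1 [i2 [p2 [pi1 pi2 ip hM]]]]]]].
have [L1 SL1 /isomorphicP[g1 [g1' [gg1 hg1]]]] := h1 K1 I.
have [L2 SL2 /isomorphicP[g2 [g2' [gg2 hg2]]]] := h2 K2 I.
exists (sum L1 L2); first by exists L1 => //; exists L2.
apply/isomorphicP.
exists (fun x => i1 x *m g1 x *m q1 x + i2 x *m g2 x *m q2 x).
exists (fun x => j1 x *m g1' x *m p1 x + j2 x *m g2' x *m p2 x).
split=> [x|a]; first by rewrite mul_blocks ?qj1 ?qj2 ?jq // gg1 gg2 !mulmx1 ip.
by rewrite hM /sum !mul_blocks ?pi1 ?pi2 ?qj1 ?qj2 ?ip ?jq // hg1 hg2.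
Qed.

Lemma decomposable_decomposes d (M : representation k d) : ~ indecomposable M ->
  exists d1 d2, [/\ (total_dim d1 < total_dim d)%N, (total_dim d2 < total_dim d)%N,
    forall x, (d1 x <= d x)%N, forall x, (d2 x <= d x)%N & decomposes_as d1 d2 M].
Proof.
move=> /existsNP[e] /not_implyP[he] /not_implyP[ee] /not_orP[e0 e1].
have proper d' (i : graded k d' d) (p : graded k d d') : (forall x, p x *m i x = 1%:M) ->
    ~ (forall x, i x *m p x = 1%:M) -> (total_dim d' < total_dim d)%N.
  move=> pi nip; have le x : (d' x <= d x)%N by exact: mulmx1_leq (pi x).
  rewrite ltn_neqAle leq_sum ?andbT //; apply/negP => /eqP tot; apply: nip => x.
  have e0' : d' x = d x.
    have := leqif_sum (fun x (_ : true) => leqif_eq (le x)).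
    by move=> /= [_]; rewrite -/(total_dim d') tot eqxx => /esym/forallP/(_ x)/eqP.
  move: (i x) (p x) (pi x); rewrite e0' => u v vu.
  exact: mulmx1C.
have [d1 [K1 [i1 [p1 [hi1 hp1 pi1 ip1]]]]] := idempotent_split he ee.
have he' : is_hom M M (fun x => 1%:M - e x).
  by move=> a; rewrite mulmxBr mulmxBl mulmx1 mul1mx he.
have [|d2 [K2 [i2 [p2 [hi2 hp2 pi2 ip2]]]]] := idempotent_split he'.
  by move=> x; rewrite mulmxBr mulmx1 mulmxBl mul1mx ee subrr subr0.
exists d1, d2; split.
- by apply: (proper _ i1 p1) => // z; apply: e1 => x; rewrite -ip1.
- apply: (proper _ i2 p2) => // z; apply: e0 => x.
  by have := z x; rewrite ip2 => /eqP; rewrite subr_eq addrC -subr_eq subrr => /eqP.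
- by move=> x; exact: mulmx1_leq (pi1 x).
- by move=> x; exact: mulmx1_leq (pi2 x).
- exists K1, K2, i1, p1, i2, p2; split=> // [x|a].
    by rewrite ip1 ip2 addrC subrK.
  rewrite -hi1 -hi2 -!mulmxA ip1 ip2 -mulmxDr addrC subrK.
  by rewrite mulmx1.
Qed.

(** A representation is either rigid, and there is at most one rigid
    representation of given dimension vector, or it is the sum of two smaller
    ones, and these are finitely many by induction. *)
Theorem tits_positive_finite (D : dimension_vector Q) :
  tits_positive_below D ->
  forall d, (forall x, d x <= D x)%N ->
  finitely_represented (fun M : representation k d => True).
Proof.
move=> pos d; have [n] := ubnP (total_dim d).
elim: n d => // n IH d /ltnSE dn dD.
have [S0 fS0 hS0] : finitely_represented (fun M : representation k d => rigid M).
  have [[R rigR]|no] := pselect (exists R : representation k d, rigid R).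
    exists [set R] => [|M rigM]; first exact: finite_set1.
    by exists R => //; exact: rigid_isomorphic.
  by exists set0 => // M rigM; case: no; exists M.
pose I := {ffun vertex Q -> 'I_(total_dim d).+1}%type.
pose dv (f : I) : dimension_vector Q := fun x => f x.
have /dependent_choice_fun[T hT] (s : I * I) : exists T : set (representation k d),
    finite_set T /\ forall M,
    (forall x, dv s.1 x <= D x)%N -> (forall x, dv s.2 x <= D x)%N ->
    (total_dim (dv s.1) < total_dim d)%N -> (total_dim (dv s.2) < total_dim d)%N ->
    decomposes_as (dv s.1) (dv s.2) M -> exists2 N, T N & isomorphic N M.
  have [[D1 D2 t1 t2]|no] := pselect [/\ (forall x, dv s.1 x <= D x)%N,
     (forall x, dv s.2 x <= D x)%N, (total_dim (dv s.1) < total_dim d)%N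
   & (total_dim (dv s.2) < total_dim d)%N].
    have [|//|T fT hT] := @decomposes_finite (dv s.1) (dv s.2) d.
    - by apply: IH => //; apply: leq_trans dn.
    - by apply: IH => //; apply: leq_trans dn.
    by exists T; split=> // M _ _ _ _; exact: hT.
  by exists set0; split=> // M *; case: no.
exists (S0 `|` \bigcup_s T s).
  rewrite finite_setU; split=> //; apply: bigcup_finite => [|s _]; last by have [] := hT s.
  exact: finite_finset.
move=> M _; have [rigM|nrig] := pselect (rigid M).
  by have [N] := hS0 M rigM; exists N => //; left.
have : ~ indecomposable M.
  move=> indM; apply: nrig; have [d0|d0] := posnP (total_dim d).
    move=> c; exists (fun=> 0) => a; apply/matrixP => i; exfalso.
    move: d0 => /eqP; rewrite /total_dim sum_nat_eq0 => /forallP/(_ (target a))/eqP d0.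
    by case: i; rewrite d0.
  exact: indecomposable_rigid pos _ _ dD d0 indM.
move=> /decomposable_decomposes[d1 [d2 [t1 t2 le1 le2 dec]]].
have bound d' : (forall x, d' x <= d x)%N -> exists f : I, dv f = d'.
  move=> le; have lt x : (d' x < (total_dim d).+1)%N.
    by rewrite ltnS (leq_trans (le x)) // /total_dim (bigD1 x) //= leq_addr.
  by exists [ffun x => Ordinal (lt x)]; apply/funext=> x; rewrite /dv ffunE.
have [[f1 e1] [f2 e2]] := (bound _ le1, bound _ le2); move: dec; subst d1 d2 => dec.
have [N TN iso] := (hT (f1, f2)).2 M (fun x => leq_trans (le1 x) (dD x))
  (fun x => leq_trans (le2 x) (dD x)) t1 t2 dec.
by exists N => //; right; exists (f1, f2).
Qed.

End Finiteness.

(** * Graphs with a harmonic weight *)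

Section HarmonicGraphs.
Variables (V : finType) (e : rel V) (w : V -> nat).
Hypothesis esym : symmetric e.
Hypothesis eirr : irreflexive e.

(** In a forest these walks are the paths without repetition
    (nonbacktracking_uniq), but they can be concatenated by looking only at the
    junction. *)
Fixpoint nonbacktracking (s : seq V) : bool :=
  if s isn't x :: t then true else
  if t isn't y :: t' then true else
  [&& e x y, (if t' is z :: _ then x != z else true) & nonbacktracking t].

Lemma nonbacktracking_path x s : nonbacktracking (x :: s) -> path e x s.
Proof. by elim: s x => //= y s IH x /and3P[-> _ /IH]. Qed.

Lemma nonbacktracking_catrev s b t :
  nonbacktracking (b :: s) -> nonbacktracking (b :: t) ->
  (forall x y, ohead s = Some x -> ohead t = Some y -> x <> y) ->
  nonbacktracking (catrev s (b :: t)).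
Proof.
elim: s b t => //= y s IH b t /and3P[by_ ys nbs] nbt yt.
apply: IH => //=.
  rewrite esym by_ /= nbt andbT.
  by case: t nbt yt => //= z t _ /(_ y z erefl erefl)/eqP.
by case: s ys {nbs} => //= x s bx u v [<-] [<-] xb; rewrite xb eqxx in bx.
Qed.

Lemma nonbacktracking_rev s : nonbacktracking s -> nonbacktracking (rev s).
Proof.
case: s => // b s nbs; rewrite -cat1s rev_cat -catrevE.
exact: nonbacktracking_catrev.
Qed.

Section Forest.
Hypothesis acyclic : forall c, ucycle e c -> (size c < 3)%N.

(** The first return of a walk to its starting point would be a cycle. *)
Lemma nonbacktracking_uniq s : nonbacktracking s -> uniq s.
Proof.
elim: s => //= x t IH nbt.
have nbt' : nonbacktracking t by case: t nbt {IH} => //= y t /and3P[].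
have ut := IH nbt'; rewrite ut andbT; apply/negP => xt.
have pt := nonbacktracking_path nbt.
case/splitPr: xt nbt nbt' ut pt {IH} => t1 t2 nbt _ ut pt.
have : ucycle e (x :: t1).
  apply/andP; split; first by move: pt; rewrite -cat_rcons cat_path => /andP[].
  by move: ut; rewrite cat_uniq /= negb_or => /and3P[-> /andP[-> _] _].
move=> /acyclic /=; case: t1 nbt {ut pt} => [|y [|z t1]] //=.
  by rewrite eirr.
by rewrite eqxx andbF.
Qed.

(** The vertices vs form a copy of the tree with list of parents ps, whose
    weights ws are bounded by w. *)
Definition contains_tree (ps ws : seq nat) : Prop :=
  exists vs : seq V, [/\ size vs = (size ps).+1, uniq vs,
    forall x0 i, (i < size ps)%N -> e (nth x0 vs i.+1) (nth x0 vs (nth 0%N ps i))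
  & forall x0 i, (i <= size ps)%N -> (nth 0%N ws i <= w (nth x0 vs i))%N].

(* The excluded trees are the Euclidean diagrams of types D and E, encoded as for
   tree_quiver. *)
Hypothesis noD : forall m,
  ~ contains_tree (iota 0 m ++ [:: 0; 0; m; m])%N (nseq m.+1 2 ++ [:: 1; 1; 1; 1])%N.
Hypothesis epos : forall x y, e x y -> (0 < w y)%N.
Hypothesis harmonic : forall x, (0 < w x)%N -> (2 * w x = \sum_(y | e x y) w y)%N.

Definition degree x := #|[pred y | e x y]|.

Lemma le_neighbours x s : (0 < w x)%N -> uniq s -> all (e x) s ->
  (\sum_(y <- s) w y <= 2 * w x)%N.
Proof.
move=> wx us /allP es; rewrite harmonic // big_uniq //=.
rewrite [X in (_ <= X)%N](bigID (mem s)) /=.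
apply: leq_trans (leq_addr _ _); rewrite leq_eqVlt; apply/orP; left; apply/eqP.
by apply: eq_bigl => y; rewrite andb_idl // => /es.
Qed.

Lemma neighbour_neq x y : (2 <= degree x)%N -> exists2 z, e x z & z != y.
Proof.
move=> dx; case: (pickP [pred z | e x z & z != y]) => [z /andP[]|h]; first by exists z.
suff : (degree x <= 1)%N by rewrite leqNgt dx.
rewrite -(card1 y); apply/subset_leq_card/fintype.subsetP=> z; rewrite !inE => xz.
by move: (h z); rewrite /= xz => /negbFE.
Qed.

Lemma two_neighbours_neq x y : (3 <= degree x)%N ->
  exists z1 z2, [/\ e x z1, e x z2, uniq [:: z1; z2] & y \notin [:: z1; z2]].
Proof.
move=> dx; have [z1 xz1 z1y] := neighbour_neq y (ltnW dx).
case: (pickP [pred z | [&& e x z, z != y & z != z1]]) => [z2 /and3P[xz2 z2y z21]|h].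
  exists z1, z2; split=> //; first by rewrite /= andbT inE eq_sym.
  by rewrite !inE negb_or eq_sym z1y eq_sym z2y.
suff : (degree x <= 2)%N by rewrite leqNgt dx.
apply: leq_trans (_ : #|pred2 y z1| <= 2)%N; last by rewrite card2; case: eqP.
apply/subset_leq_card/fintype.subsetP=> z; rewrite !inE => xz.
by move: (h z); rewrite /= xz /=; case: (z == y) (z == z1) => [] [].
Qed.

(** A vertex of weight 1 has neighbours of total weight 2, so a walk cannot step
    from weight at least 2 down to weight 1 and go on. *)
Lemma weight_ge2 b s : (2 <= w b)%N -> nonbacktracking (b :: s) ->
  (s != [::] -> (2 <= degree (last b s))%N) -> all (fun x => 2 <= w x)%N (b :: s).
Proof.
elim: s b => [|y s IH] b wb; first by rewrite /= wb.
move=> /= /and3P[by_ ys nbs] /(_ isT) dl; rewrite wb /=; apply: IH => //.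
have wy : (0 < w y)%N by exact: epos by_.
have [z yz zb] : exists2 z, e y z & z != b.
  case: s ys nbs dl => [|z s] bz nbs dl; first exact: neighbour_neq.
  by exists z; [move: nbs => /= /andP[]|rewrite eq_sym].
have := @le_neighbours y [:: z; b] wy.
rewrite /= inE zb yz esym by_ big_cons big_seq1 => /(_ isT isT).
have := epos yz; move: wb; move: (w z) (w b) (w y); lia.
Qed.

Lemma branch_weight b : (3 <= degree b)%N -> (2 <= w b)%N.
Proof.
move=> db; have [z bz _] := neighbour_neq b (ltnW db).
have [z1 [z2 [bz1 bz2 u12]]] := two_neighbours_neq z db.
have wb : (0 < w b)%N by apply: (@epos z); rewrite esym.
rewrite !inE negb_or => /andP[n1 n2].
have := @le_neighbours b [:: z; z1; z2] wb.
rewrite !big_cons big_nil /= bz bz1 bz2 !inE negb_or n1 n2.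
move: u12; rewrite /= inE => -> /(_ isT isT).
have := (epos bz, epos bz1, epos bz2); move: (w z) (w z1) (w z2) (w b) => ? ? ? ? [[]].
lia.
Qed.

(** A path of weights at least 2 with two further neighbours at either end is a
    diagram of type D. The path may consist of one vertex. *)
Lemma typeD_tree b s u1 u2 t1 t2 : path e b s ->
  uniq (b :: s ++ [:: u1; u2; t1; t2]) -> all (fun x => 2 <= w x)%N (b :: s) ->
  e b u1 -> e b u2 -> e (last b s) t1 -> e (last b s) t2 -> False.
Proof.
move=> ps us ws bu1 bu2 lt1 lt2; apply: (noD (m := size s)).
exists (b :: s ++ [:: u1; u2; t1; t2]); split=> // [|x0 i|x0 i].
- by rewrite /= !size_cat size_iota.
- rewrite size_cat size_iota [size [:: _; _; _; _]]/= => im.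
  rewrite [nth 0%N _ i]nth_cat size_iota; case: ltnP => [lt|ge].
    have nthl j : (j <= size s)%N ->
        nth x0 (b :: s ++ [:: u1; u2; t1; t2]) j = nth x0 (b :: s) j.
      by move=> js; rewrite -cat_cons nth_cat [size (b :: s)]/= ltnS js.
    rewrite nth_iota // add0n esym !nthl ?(ltnW lt) //.
    by move/pathP: ps => /(_ x0 i lt).
  have lastE : nth x0 (b :: s ++ [:: u1; u2; t1; t2]) (size s) = last b s.
    rewrite -cat_cons nth_cat /= ltnSn.
    by rewrite (last_nth x0).
  have [j ij j4] : exists2 j, i = (size s + j)%N & (j < 4)%N.
    exists (i - size s)%N; first by rewrite subnKC.
    by rewrite ltn_subLR.
  have -> : nth x0 (b :: s ++ [:: u1; u2; t1; t2]) i.+1 = nth x0 [:: u1; u2; t1; t2] j.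
    by rewrite ij /= nth_cat ltnNge leq_addr addKn.
  rewrite ij addKn; case: j j4 {ij im ge} => [|[|[|[|//]]]] _ /=.
  + by rewrite esym.
  + by rewrite esym.
  + by rewrite esym lastE.
  + by rewrite esym lastE.
- rewrite size_cat size_iota [size [:: _; _; _; _]]/= -cat_cons => im.
  rewrite [nth 0%N _ i]nth_cat [nth x0 _ i]nth_cat size_nseq [size (b :: s)]/=.
  case: ltnP => [lt|ge]; first by rewrite nth_nseq lt; move/all_nthP: ws; apply.
  have : (i - (size s).+1 < 4)%N by lia.
  case: (i - _)%N => [|[|[|[|//]]]] _ /=.
  + exact: epos bu1.
  + exact: epos bu2.
  + exact: epos lt1.
  + exact: epos lt2.
Qed.

(** The walk between two vertices of degree at least 3 has weights at least 2
    by weight_ge2, so the two vertices and their other neighbours would span a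
    diagram of type D. *)
Lemma no_second_branch b s : s != [::] -> nonbacktracking (b :: s) ->
  (3 <= degree b)%N -> (degree (last b s) <= 2)%N.
Proof.
case: s => // y s _ nbs db; rewrite leqNgt; apply/negP => dl.
have [u1 [u2 [bu1 bu2 uu uy]]] := two_neighbours_neq y db.
have := nonbacktracking_rev nbs.
case/lastP def_s: {2}(y :: s) (erefl (y :: s)) => [//|p l] ps.
have el : last b (y :: s) = l by rewrite ps last_rcons.
rewrite ps -rcons_cons rev_rcons.
have [y' [r revE]] : exists y' r, rev (b :: p) = y' :: r.
  by case: (rev (b :: p)) (size_rev (b :: p)) => // y' r _; exists y', r.
have [t1 [t2 [lt1 lt2 tt ty]]] := two_neighbours_neq y' dl.
move=> nbr; rewrite el in lt1 lt2.
have walk u t : e b u -> u != y -> e l t -> t != y' ->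
    uniq (u :: rcons (b :: y :: s) t).
  move=> bu uy' lt ty'; apply: nonbacktracking_uniq.
  have : nonbacktracking (t :: l :: rev (b :: p)).
    by move: nbr; rewrite revE /= (esym t l) lt ty'.
  move=> /nonbacktracking_rev; rewrite (rev_cons t) (rev_cons l) revK rcons_cons -ps.
  by move=> nbt; rewrite [nonbacktracking _]/= (esym u b) bu uy'.
have all2 : all (fun x => 2 <= w x)%N (b :: y :: s).
  by apply: weight_ge2 => // [|_]; [exact: branch_weight|exact: ltnW].
apply: (typeD_tree (nonbacktracking_path nbs) _ all2 bu1 bu2 (t1 := t1) (t2 := t2));
  rewrite ?el //.
move: uy ty; rewrite !inE !negb_or => /andP[yu1 yu2] /andP[yt1 yt2].
have := (walk u1 t1 bu1, walk u2 t1 bu2, walk u1 t2 bu1, walk u2 t2 bu2).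
rewrite ![_ == y]eq_sym yu1 yu2 ![_ == y']eq_sym yt1 yt2 lt1 lt2.
move=> [[[/(_ isT isT isT) w1 /(_ isT isT isT) w2] /(_ isT isT isT) w3] /(_ isT isT isT) w4].
rewrite -cat_cons; move: (b :: y :: s) w1 w2 w3 w4 uu tt => P.
rewrite /= cat_uniq /= !mem_rcons !rcons_uniq !inE !negb_or.
move=> /andP[/andP[u1t1 ->] /andP[-> ->]] /andP[/andP[u2t1 ->] _].
move=> /andP[/andP[u1t2 _] /andP[-> _]] /andP[/andP[u2t2 _] _].
by move=> /andP[-> _] /andP[-> _]; rewrite u1t1 u2t1 u1t2 u2t2.
Qed.

(** arm b s says that s is the whole branch of the forest at b that starts with
    the first vertex of s, and that this branch is a path. *)
Inductive arm : V -> seq V -> Prop :=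
  | arm_leaf b y : (forall z, e y z = (z == b)) -> arm b [:: y]
  | arm_step b y z s : b != z -> (forall x, e y x = (x == b) || (x == z)) ->
      arm y (z :: s) -> arm b (y :: z :: s).

Lemma arm_nonbacktracking b s : arm b s -> nonbacktracking (b :: s).
Proof.
elim=> [{}b y yE|{}b y z {}s bz yE _ nbs]; first by rewrite /= esym yE eqxx.
by rewrite /= in nbs *; rewrite esym yE eqxx bz.
Qed.

(** Walk away from b; the walk cannot go on for ever because it never repeats a
    vertex, and it never has a choice because all degrees are at most 2. *)
Lemma arm_exists b y : e b y ->
  (forall s, nonbacktracking (b :: y :: s) -> (degree (last y s) <= 2)%N) ->
  exists s, arm b (y :: s).
Proof.
move=> by_ deg2.
have [n] : exists n, forall s, nonbacktracking (b :: y :: s) -> (size s < n)%N.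
  exists #|V| => s /nonbacktracking_uniq/card_uniqP cu.
  by have := max_card (mem (b :: y :: s)); rewrite cu /=; lia.
elim: n b y by_ deg2 => [|n IH] b y by_ deg2 lim.
  by have := lim [::]; rewrite /= by_ => /(_ isT).
have dy : (degree y <= 2)%N by apply: (deg2 [::]); rewrite /= by_.
case: (pickP [pred z | e y z & z != b]) => [z /andP[yz zb]|h]; last first.
  exists [::]; apply: arm_leaf => z; apply/idP/eqP => [yz|->]; last by rewrite esym.
  by move: (h z); rewrite /= yz => /negbFE/eqP.
have nbz s : nonbacktracking (y :: z :: s) -> nonbacktracking (b :: y :: z :: s).
  by move=> nbs; rewrite [nonbacktracking _]/= by_ eq_sym zb.
have [s|s|s As] := IH y z yz.
- by move=> /nbz /(deg2 (z :: s)).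
- by move=> /nbz /(lim (z :: s)).
exists (z :: s); apply: arm_step => // [|x]; first by rewrite eq_sym.
apply/idP/orP => [yx|[/eqP->|/eqP->] //]; last by rewrite esym.
have [xb|xb] := eqVneq x b; [by left|right].
apply: contraTT dy => xz; rewrite -ltnNge.
have u3 : uniq [:: x; z; b] by rewrite /= !inE negb_or xz xb zb.
have <- : #|[:: x; z; b]| = 3%N := card_uniqP u3.
apply/subset_leq_card/fintype.subsetP => u.
by rewrite !inE => /or3P[] /eqP-> //; rewrite esym.
Qed.

(** Starting from the leaf, harmonicity makes w an arithmetic progression with
    initial value and difference c. *)
Lemma arm_weight b s : arm b s -> exists2 c, (0 < c)%N &
  forall x0 i, (i <= size s)%N -> w (nth x0 (b :: s) i) = (((size s).+1 - i) * c)%N.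
Proof.
elim=> [{}b y yE|{}b y z {}s bz yE _ [c c0 IH]].
  have yb : e y b by rewrite yE.
  have wy : (0 < w y)%N by apply: (@epos b); rewrite esym.
  exists (w y) => // x0 [_|[_|]] //=; last by rewrite mul1n.
  by rewrite harmonic // (eq_bigl _ _ yE) big_pred1_eq.
exists c => // x0 [_|i] /=; last by rewrite ltnS subSS => /(IH x0).
have wy : (0 < w y)%N by apply: (@epos z); rewrite esym yE eqxx orbT.
have := harmonic wy; rewrite (bigD1 b) ?yE ?eqxx //=.
rewrite (big_pred1 z) => [|x]; last first.
  by rewrite [RHS]/= yE; have [->|_] := eqVneq x b; rewrite ?(negPf bz) ?andbT ?andbF.
have /= := (IH z 0%N isT); have /= := (IH z 1%N isT); rewrite subn0 => -> ->.
lia.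
Qed.

(** Otherwise the arms starting with x - y and with y - x would show that
    w x > w y and w y > w x. *)
Lemma branch_exists x y : e x y -> exists b, (3 <= degree b)%N.
Proof.
move=> xy; apply: contrapT => nb.
have deg2 z : (degree z <= 2)%N by rewrite leqNgt; apply/negP => dz; apply: nb; exists z.
have [s /arm_weight[c c0 wc]] := arm_exists xy (fun s _ => deg2 _).
have yx : e y x by rewrite esym.
have [t /arm_weight[c' c'0 wc']] := arm_exists yx (fun s _ => deg2 _).
have := (wc x 0%N isT, wc x 1%N isT, wc' x 0%N isT, wc' x 1%N isT) => /= [[[[]]]].
lia.
Qed.

Hypothesis noE6 : ~ contains_tree [:: 0; 1; 0; 3; 0; 5]%N [:: 3; 2; 1; 2; 1; 2; 1]%N.
Hypothesis noE7 :
  ~ contains_tree [:: 0; 1; 2; 0; 4; 5; 0]%N [:: 4; 3; 2; 1; 3; 2; 1; 2]%N.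
Hypothesis noE8 :
  ~ contains_tree [:: 0; 1; 2; 3; 4; 0; 6; 0]%N [:: 6; 5; 4; 3; 2; 1; 4; 2; 3]%N.

(** The equations say that 1/p0 + 1/p1 + 1/p2 = 1. *)
Lemma star_arithmetic n p0 p1 p2 c0 c1 c2 :
  (1 < p0 -> p0 <= p1 -> p1 <= p2 -> 0 < c0 -> 0 < c1 -> 0 < c2 ->
  n = p0 * c0 -> n = p1 * c1 -> n = p2 * c2 -> n = c0 + c1 + c2 ->
  [\/ [/\ p0 = 3, p1 = 3 & p2 = 3], [/\ p0 = 2, p1 = 4 & p2 = 4]
    | [/\ p0 = 2, p1 = 3 & p2 = 6]])%N.
Proof.
move=> p0_gt1 p01 p12 c0_gt0 c1_gt0 c2_gt0 n0 n1 n2 n3.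
have c10 : (c1 <= c0)%N by nia.
have c21 : (c2 <= c1)%N by nia.
have : (p0 <= 3)%N by nia.
have [p0_2|p0_3 _] := leqP p0 2; last first.
  have e0 : p0 = 3%N by nia.
  have e1 : p1 = 3%N by nia.
  have e2 : p2 = 3%N by nia.
  by constructor 1.
have e0 : p0 = 2%N by lia.
have : (p1 <= 4)%N by nia.
have [p1_3|p1_4] := leqP p1 3; move=> _.
  have e1 : p1 = 3%N by nia.
  have e2 : p2 = 6%N by nia.
  by constructor 3.
have e1 : p1 = 4%N by nia.
have e2 : p2 = 4%N by nia.
by constructor 2.
Qed.

(** Counting the center, the arms have 3, 3, 3 or 2, 4, 4 or 2, 3, 6 vertices,
    the shapes of the diagrams of type E. *)
Lemma no_three_arms b y0 y1 y2 s0 s1 s2 :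
  arm b (y0 :: s0) -> arm b (y1 :: s1) -> arm b (y2 :: s2) ->
  uniq (b :: (y2 :: s2) ++ (y1 :: s1) ++ (y0 :: s0)) ->
  (2 * w b = w y0 + w y1 + w y2)%N ->
  (size s0 <= size s1)%N -> (size s1 <= size s2)%N -> False.
Proof.
move=> A0 A1 A2 us wb s01 s12.
have [c0 c0_gt0 w0] := arm_weight A0; have [c1 c1_gt0 w1] := arm_weight A1.
have [c2 c2_gt0 w2] := arm_weight A2.
have p0 := nonbacktracking_path (arm_nonbacktracking A0).
have p1 := nonbacktracking_path (arm_nonbacktracking A1).
have p2 := nonbacktracking_path (arm_nonbacktracking A2).
have := (w0 b 0%N isT, w1 b 0%N isT, w2 b 0%N isT); rewrite /= !subn0 => -[[b0 b1] b2].
have := (w0 b 1%N isT, w1 b 1%N isT, w2 b 1%N isT); rewrite /= !subn1 /= => -[[h0 h1] h2].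
have [] := @star_arithmetic (w b) (size s0).+2 (size s1).+2 (size s2).+2 c0 c1 c2.
all: rewrite ?ltnS //.
- by rewrite b0 in wb h0 h1 h2 *; lia.
- case=> [[z0] [z1] [z2]]; apply: noE6.
  exists (b :: (y2 :: s2) ++ (y1 :: s1) ++ (y0 :: s0)).
  case: s0 s1 s2 z0 z1 z2 us p0 p1 p2 w0 w1 w2
    {A0 A1 A2 wb s01 s12 b0 b1 b2 h0 h1 h2}
    => [|u0 [|//]] // [|u1 [|//]] // [|u2 [|//]] // _ _ _ us p0 p1 p2 w0 w1 w2.
  split=> // x i.
    move: p0 p1 p2 => /= /and3P[? ? _] /and3P[? ? _] /and3P[? ? _].
    by case: i => [|[|[|[|[|[|]]]]]] //= _; rewrite esym.
  move: (w2 x 0 isT) (w2 x 1 isT) (w2 x 2 isT) (w1 x 1 isT) (w1 x 2 isT)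
    (w0 x 1 isT) (w0 x 2 isT)%N => /=.
  by case: i => [|[|[|[|[|[|[|]]]]]]] //= *; lia.
- case=> [[z0] [z1] [z2]]; apply: noE7.
  exists (b :: (y2 :: s2) ++ (y1 :: s1) ++ (y0 :: s0)).
  case: s0 s1 s2 z0 z1 z2 us p0 p1 p2 w0 w1 w2 h0
    {A0 A1 A2 wb s01 s12 b0 b1 b2 h1 h2}
    => [|//] [|u1 [|v1 [|//]]] // [|u2 [|v2 [|//]]] // _ _ _ us p0 p1 p2 w0 w1 w2 h0.
  split=> // x i.
    move: p0 p1 p2 => /= /andP[? _] /and4P[? ? ? _] /and4P[? ? ? _].
    by case: i => [|[|[|[|[|[|[|]]]]]]] //= _; rewrite esym.
  move: (w2 x 0 isT) (w2 x 1 isT) (w2 x 2 isT) (w2 x 3 isT) (w1 x 0 isT) (w1 x 1 isT)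
    (w1 x 2 isT) (w1 x 3 isT) (w0 x 0 isT) (w0 x 1 isT)%N => /=.
  by case: i => [|[|[|[|[|[|[|[|]]]]]]]] //= *; lia.
- case=> [[z0] [z1] [z2]]; apply: noE8.
  exists (b :: (y2 :: s2) ++ (y1 :: s1) ++ (y0 :: s0)).
  case: s0 s1 s2 z0 z1 z2 us p0 p1 p2 w0 w1 w2 h0
    {A0 A1 A2 wb s01 s12 b0 b1 b2 h1 h2}
    => [|//] [|u1 [|//]] // [|u2 [|v2 [|x2 [|t2 [|//]]]]] // _ _ _ us p0 p1 p2 w0 w1 w2 h0.
  split=> // x i.
    move: p0 p1 p2 => /= /andP[? _] /and3P[? ? _] /and5P[? ? ? ? /andP[? _]].
    by case: i => [|[|[|[|[|[|[|[|]]]]]]]] //= _; rewrite esym.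
  move: (w2 x 0 isT) (w2 x 1 isT) (w2 x 2 isT) (w2 x 3 isT) (w2 x 4 isT) (w2 x 5 isT)
    (w1 x 0 isT) (w1 x 1 isT) (w1 x 2 isT) (w0 x 0 isT) (w0 x 1 isT)%N => /=.
  by case: i => [|[|[|[|[|[|[|[|[|]]]]]]]]] //= *; lia.
Qed.

Theorem no_harmonic_weight x y : e x y -> False.
Proof.
move=> /branch_exists[b db].
have deg2 z s : nonbacktracking (b :: z :: s) -> (degree (last z s) <= 2)%N.
  by move=> nbs; exact: (no_second_branch _ nbs db).
have wb := branch_weight db.
have [y0 by0 _] := neighbour_neq b (ltnW db).
have [y1 [y2 [by1 by2 u12]]] := two_neighbours_neq y0 db.
rewrite !inE negb_or => /andP[y01 y02].
have bz z : e b z -> b != z by apply: contraTneq => <-; rewrite eirr.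
have bE z : e b z = (z \in [:: y0; y1; y2]).
  apply/idP/idP=> [ez|]; last by rewrite !inE => /or3P[] /eqP->.
  apply: contraT; rewrite !inE !negb_or => /and3P[z0 z1 z2].
  have [] := @typeD_tree b [::] y0 y1 y2 z.
  - by [].
  - move: u12; rewrite /= !inE !negb_or !bz // y01 y02 !andbT /= => ->.
    by rewrite ![_ == z]eq_sym z0 z1 z2.
  - by rewrite /= wb.
  - by [].
  - by [].
  - by [].
  - by [].
have [s0 A0] := arm_exists by0 (deg2 y0).
have [s1 A1] := arm_exists by1 (deg2 y1).
have [s2 A2] := arm_exists by2 (deg2 y2).
have u3 : uniq [:: y0; y1; y2].
  by move: u12; rewrite /= !inE !negb_or y01 y02 !andbT => ->.
have wsum : (2 * w b = w y0 + w y1 + w y2)%N.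
  rewrite harmonic ?(ltnW wb) // (eq_bigl _ _ bE) -big_uniq //=.
  by rewrite !big_cons big_nil addn0 addnA.
have disj z z' s s' : arm b (z :: s) -> arm b (z' :: s') -> z != z' ->
    ~~ has (mem (z' :: s')) (z :: s).
  move=> /arm_nonbacktracking nbs /arm_nonbacktracking nbs' zz'.
  have /nonbacktracking_uniq : nonbacktracking (catrev (z :: s) (b :: z' :: s')).
    by apply: nonbacktracking_catrev => // _ _ [<-] [<-]; exact/eqP.
  rewrite catrevE cat_uniq => /and3P[_ + _]; apply: contra.
  move=> /hasP[u us us']; apply/hasP; exists u; rewrite /= ?mem_rev //.
  by rewrite inE [u \in _]us' orbT.
have barm z s : arm b (z :: s) -> uniq (b :: z :: s).
  by move/arm_nonbacktracking/nonbacktracking_uniq.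
have y12 : y1 != y2 by move: u12; rewrite /= inE andbT.
have sorted z0 z1 z2 t0 t1 t2 : arm b (z0 :: t0) -> arm b (z1 :: t1) ->
    arm b (z2 :: t2) -> z0 != z1 -> z0 != z2 -> z1 != z2 ->
    (2 * w b = w z0 + w z1 + w z2)%N -> (size t0 <= size t1)%N ->
    (size t1 <= size t2)%N -> False.
  move=> B0 B1 B2 z01 z02 z12 wz t01 t12.
  apply: (no_three_arms B0 B1 B2 _ wz t01 t12).
  move: (barm _ _ B0) (barm _ _ B1) (barm _ _ B2).
  move: (disj _ _ _ _ B0 B1 z01) (disj _ _ _ _ B0 B2 z02) (disj _ _ _ _ B1 B2 z12).
  move: (z0 :: t0) (z1 :: t1) (z2 :: t2) => C0 C1 C2 d01 d02 d12.
  rewrite !cons_uniq => /andP[b0 uC0] /andP[b1 uC1] /andP[b2 uC2].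
  rewrite !mem_cat !negb_or b0 b1 b2 !cat_uniq has_cat negb_or uC0 uC1 uC2.
  by rewrite d01 d02 d12.
have [y10 y20 y21] : [/\ y1 != y0, y2 != y0 & y2 != y1].
  by rewrite ![y1 == _]eq_sym ![y2 == _]eq_sym.
have [l01|/ltnW l01] := leqP (size s0) (size s1);
have [l12|/ltnW l12] := leqP (size s1) (size s2);
have [l02|/ltnW l02] := leqP (size s0) (size s2).
- by apply: (sorted _ _ _ _ _ _ A0 A1 A2) => //; clear -wsum; lia.
- by apply: (sorted _ _ _ _ _ _ A0 A1 A2) => //; clear -wsum; lia.
- by apply: (sorted _ _ _ _ _ _ A0 A2 A1) => //; clear -wsum; lia.
- by apply: (sorted _ _ _ _ _ _ A2 A0 A1) => //; clear -wsum; lia.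
- by apply: (sorted _ _ _ _ _ _ A1 A0 A2) => //; clear -wsum; lia.
- by apply: (sorted _ _ _ _ _ _ A1 A2 A0) => //; clear -wsum; lia.
- by apply: (sorted _ _ _ _ _ _ A2 A1 A0) => //; clear -wsum; lia.
- by apply: (sorted _ _ _ _ _ _ A2 A1 A0) => //; clear -wsum; lia.
Qed.

End Forest.
End HarmonicGraphs.

(** * Euclidean subquivers *)

Definition has_euclidean (Q : quiver) (d : dimension_vector Q) : Prop :=
  exists (S : subquiver Q) (h : dimension_vector S),
    euclidean_with h /\ forall x : vertex S, (h x <= d (val x))%N.

Section Embeddings.
Variables (Q : quiver) (d : dimension_vector Q).

Definition joins (a : arrow Q) x y :=
  (source a, target a) = (x, y) \/ (source a, target a) = (y, x).

(** It is enough to embed the diagram; the subquiver is its image, and the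
    orientation of the edges may differ. *)
Lemma has_euclidean_embedding (T : euclidean_type)
    (f : vertex (euclidean_diagram T) -> vertex Q)
    (g : arrow (euclidean_diagram T) -> arrow Q) :
  injective f -> injective g ->
  (forall a, joins (g a) (f (source a)) (f (target a))) ->
  (forall x, (euclidean_weight x <= d (f x))%N) -> has_euclidean d.
Proof.
move=> finj ginj gf wd.
pose SV := [set f x | x in [set: vertex (euclidean_diagram T)]]%SET.
pose SA := [set g x | x in [set: arrow (euclidean_diagram T)]]%SET.
have inSV x : f x \in SV by apply: imset_f.
have hs a : a \in SA -> source a \in SV.
  by case/imsetP=> b _ ->; case: (gf b) => [[-> _]|[-> _]].
have ht a : a \in SA -> target a \in SV.
  by case/imsetP=> b _ ->; case: (gf b) => [[_ ->]|[_ ->]].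
pose S := Subquiver hs ht.
have /dependent_choice_fun[fi fiE] (v : vertex S) : exists x, f x = val v.
  by have /imsetP[x _ ->] := valP v; exists x.
have /dependent_choice_fun[gi giE] (b : arrow S) : exists a, g a = val b.
  by have /imsetP[x _ ->] := valP b; exists x.
have fi_bij : bijective fi.
  exists (fun x => Sub (f x) (inSV x)) => x; first by apply: val_inj; rewrite /= fiE.
  by apply: finj; rewrite fiE.
have inSA a : g a \in SA by apply: imset_f.
have gi_bij : bijective gi.
  exists (fun x => Sub (g x) (inSA x)) => x; first by apply: val_inj; rewrite /= giE.
  by apply: ginj; rewrite giE.
have ends (a : arrow S) :
    (source (gi a), target (gi a)) = (fi (source a), fi (target a)) \/
    (source (gi a), target (gi a)) = (fi (target a), fi (source a)).
  have := gf (gi a); rewrite giE.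
  have es := fiE (source a); have et := fiE (target a).
  by case=> -[e1 e2]; [left|right]; congr pair; apply: finj; rewrite ?es ?et.
exists S, (fun x => euclidean_weight (fi x)); split.
  by exists T, (GraphIso fi_bij gi_bij ends).
by move=> x; rewrite -fiE; apply: wd.
Qed.

Lemma double_arrow_euclidean a b : a != b -> source a != target a ->
  joins b (source a) (target a) -> (0 < d (source a))%N -> (0 < d (target a))%N ->
  has_euclidean d.
Proof.
move=> ab st ba ds dt.
apply: (@has_euclidean_embedding (EuclideanA 1)
  (fun i : 'I_2 => if i == ord0 then source a else target a)
  (fun i : 'I_2 => if i == ord0 then a else b)).
- move=> i j; case: (eqVneq i ord0) (eqVneq j ord0) => [->|ni] [->|nj] //.
  + by move=> /eqP; rewrite (negPf st).
  + by move=> /esym/eqP; rewrite (negPf st).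
  + move=> _; apply: val_inj => /=; move: i j ni nj.
    by move=> [[|[|//]] ?] [[|[|//]] ?].
- move=> i j; case: (eqVneq i ord0) (eqVneq j ord0) => [->|ni] [->|nj] //.
  + by move=> /eqP; rewrite (negPf ab).
  + by move=> /esym/eqP; rewrite (negPf ab).
  + move=> _; apply: val_inj => /=; move: i j ni nj.
    by move=> [[|[|//]] ?] [[|[|//]] ?].
- move=> [[|[|//]] ?]; rewrite /=.
    by left; congr pair.
  by case: ba; [right|left].
- by move=> i /=; case: ifP.
Qed.

(** The arrow joining a vertex to its parent determines the vertex, because
    parents come earlier in the list. *)
Lemma contains_tree_embedding (e : rel (vertex Q)) ps ws :
  (forall x y, e x y -> exists a, joins a x y) -> irreflexive e ->
  (forall i, (i < size ps)%N -> (nth 0%N ps i <= i)%N) ->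
  contains_tree e d ps ws ->
  exists (f : vertex (tree_quiver ps) -> vertex Q) (g : arrow (tree_quiver ps) -> arrow Q),
  [/\ injective f, injective g,
      forall a, joins (g a) (f (source a)) (f (target a))
    & forall x : 'I_(size ps).+1, (nth 0%N ws x <= d (f x))%N].
Proof.
move=> ej eirr le_ps [vs [svs uvs evs wvs]].
have [x0 _] : exists x : vertex Q, True by case: vs svs {uvs evs wvs} => // x; exists x.
pose f (i : 'I_(size ps).+1) := nth x0 vs i.
have finj : injective f.
  by move=> i j /eqP; rewrite /f nth_uniq ?svs // => /eqP/val_inj.
have tgt (i : 'I_(size ps)) : (@target (tree_quiver ps) i : nat) = nth 0%N ps i.
  by rewrite /= inordK // ltnS (leq_trans (le_ps i _)) // ltnW.
have /dependent_choice_fun[g gE] (i : 'I_(size ps)) :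
    exists a, joins a (f (@source (tree_quiver ps) i)) (f (@target (tree_quiver ps) i)).
  by apply: ej; rewrite /f tgt; apply: evs.
exists f, g; split=> // [i j gij|i]; last by apply: wvs; rewrite -ltnS.
have lei := le_ps i (ltn_ord i); have lej := le_ps j (ltn_ord j).
have : (i.+1 = j.+1 :> nat) \/ (i.+1 = nth 0 ps j /\ j.+1 = nth 0 ps i)%N.
  have val_eq (x y : 'I_(size ps).+1) : f x = f y -> (x : nat) = y by move/finj->.
  have := gE j; rewrite -gij /joins; case: (gE i) => -> [[]|[]].
  - by move=> /val_eq e1 _; left.
  - by move=> /val_eq e1 /val_eq e2; right; rewrite -!tgt; split.
  - by move=> /val_eq e1 /val_eq e2; right; rewrite -!tgt; split.
  - by move=> _ /val_eq e1; left.
by case=> [[/val_inj]//|[e1 e2]]; exfalso; lia.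
Qed.

Lemma ucycle_euclidean (e : rel (vertex Q)) c :
  (forall x y, e x y -> exists a, joins a x y) ->
  ucycle e c -> (2 < size c)%N -> (forall x, x \in c -> (0 < d x)%N) -> has_euclidean d.
Proof.
move=> ej /andP[cc uc] sc dc.
have [x0 _] : exists x : vertex Q, True by case: c sc {cc uc dc} => // x; exists x.
have [n ns] : exists n, size c = n.+3 by case: (size c) sc => [|[|[|n]]] // _; exists n.
pose f (i : 'I_n.+3) := nth x0 c i.
have finj : injective f.
  by move=> i j /eqP; rewrite /f nth_uniq ?ns // => /eqP/val_inj.
have /dependent_choice_fun[g gE] (i : 'I_n.+3) : exists a, joins a (f i) (f (ordS i)).
  apply: ej; have ic : f i \in c by rewrite mem_nth // ns.
  have -> : f (ordS i) = next c (f i); last exact: next_cycle.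
  rewrite next_nth ic /f index_uniq ?ns //.
  case: c cc uc sc dc ns @f finj ic => // y c cc uc sc dc [ns] f finj ic /=.
  have : (i <= n.+2)%N by rewrite -ltnS.
  rewrite leq_eqVlt => /orP[/eqP ei|lt].
    by rewrite ei modnn /= nth_default // ns.
  by rewrite modn_small //= (set_nth_default x0) // ns.
apply: (@has_euclidean_embedding (EuclideanA n.+2) f g) => //.
- move=> i j gij; have := gE j; rewrite -gij /joins.
  have ord2 (a b : 'I_n.+3) : a = ordS b -> b = ordS a -> False.
    move=> /(congr1 val) /= + /(congr1 val) /=.
    case: a b => [a /= la] [b /= lb].
    have [-> | ?] : b = n.+2 \/ (b < n.+2)%N by lia.
      by rewrite modnn => ->; rewrite modn_small // => /eqP.
    rewrite modn_small // => ->.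
    have [eb | ?] : b.+1 = n.+2 \/ (b.+1 < n.+2)%N by lia.
      by rewrite eb modnn; lia.
    by rewrite modn_small //; lia.
  case: (gE i) => -> [[]|[]].
  - by move=> /finj.
  - by move=> /finj e1 /finj e2; case: (ord2 _ _ e1).
  - by move=> /finj e1 /finj e2; case: (ord2 _ _ e2).
  - by move=> _ /finj.
- by move=> x; apply: dc; rewrite mem_nth // ns.
Qed.

End Embeddings.

(** * The support of a critical dimension vector *)

Section Critical.
Variables (Q : quiver) (w : dimension_vector Q).
Hypothesis loopless : forall a : arrow Q, source a != target a.
Hypothesis noE : ~ has_euclidean w.

Definition joinsb (a : arrow Q) x y :=
  ((source a == x) && (target a == y)) || ((source a == y) && (target a == x)).

Lemma joinsP a x y : reflect (joins a x y) (joinsb a x y).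
Proof.
apply: (iffP orP); rewrite /joins.
  by case=> /andP[/eqP-> /eqP->]; [left|right].
by case=> -[-> ->]; rewrite !eqxx; [left|right].
Qed.

Definition support_adj x y :=
  [&& [exists a, joinsb a x y], (0 < w x)%N & (0 < w y)%N].

Lemma support_adj_sym : symmetric support_adj.
Proof.
move=> x y; rewrite /support_adj [(0 < w x)%N && _]andbC; congr (_ && _).
by apply: eq_existsb => a; rewrite /joinsb orbC.
Qed.

Lemma support_adj_irr : irreflexive support_adj.
Proof.
move=> x; apply/negP => /and3P[/existsP[a] + _ _].
by rewrite /joinsb orbb => /andP[/eqP sx /eqP tx]; have := loopless a; rewrite sx tx eqxx.
Qed.

Lemma support_adj_joins x y : support_adj x y -> exists a, joins a x y.
Proof. by case/and3P=> /existsP[a /joinsP]; exists a. Qed.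

Lemma joins_unique a b x y : (0 < w x)%N -> (0 < w y)%N ->
  joinsb a x y -> joinsb b x y -> a = b.
Proof.
move=> wx wy /joinsP ja /joinsP jb; apply/eqP; apply: contrapT => /negP ab.
apply: noE; apply: (double_arrow_euclidean ab (loopless a)).
- by rewrite /joins; case: ja => -[-> ->]; case: jb => ->; [left|right|right|left].
- by case: ja => -[-> _].
- by case: ja => -[_ ->].
Qed.

Lemma support_acyclic c : ucycle support_adj c -> (size c < 3)%N.
Proof.
move=> uc; rewrite ltnNge; apply/negP=> sc; apply: noE.
apply: (ucycle_euclidean support_adj_joins uc sc) => x xc.
by have := next_cycle (andP uc).1 xc; case/and3P.
Qed.


(** Reduces the exclusion of a tree to the bound on the weights, which depends
    on the type. *)
Lemma support_tree_free ps ws :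
  (forall (f : vertex (tree_quiver ps) -> vertex Q) (g : arrow (tree_quiver ps) -> arrow Q),
  [/\ injective f, injective g,
      forall a, joins (g a) (f (source a)) (f (target a))
    & forall x : 'I_(size ps).+1, (nth 0%N ws x <= w (f x))%N] -> has_euclidean w) ->
  (forall i, (i < size ps)%N -> (nth 0%N ps i <= i)%N) ->
  ~ contains_tree support_adj w ps ws.
Proof.
move=> h le_ps ct; apply: noE.
have [f [g fg]] := contains_tree_embedding support_adj_joins support_adj_irr le_ps ct.
exact: h fg.
Qed.

Lemma support_not_harmonic x :
  (0 < w x)%N ->
  ~ (forall x, (0 < w x)%N -> (2 * w x = \sum_(y | support_adj x y) w y)%N).
Proof.
move=> wx harm.
have [y xy] : exists y, support_adj x y.
  apply/existsP; apply: contraT; rewrite negb_exists => /forallP no.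
  have := harm x wx; rewrite big_pred0 => [|y]; last exact: negPf (no y).
  by lia.
apply: (no_harmonic_weight support_adj_sym support_adj_irr support_acyclic _ _ harm _ _ _ xy).
- move=> m; apply: support_tree_free => [f g [fi gi gf wf]|i].
    apply: (@has_euclidean_embedding _ _ (EuclideanD m) f g) => // z.
    apply: leq_trans (wf z); rewrite nth_cat size_nseq ltnS [leqLHS]/=.
    case: ifP => [zm|/negbT]; first by rewrite nth_nseq ltnS zm.
    rewrite -ltnNge => zm.
    have : (z - m.+1 < 4)%N.
      have sz : size (iota 0 m ++ [:: 0; 0; m; m])%N = (m + 4)%N.
        by rewrite size_cat size_iota.
      have zlt : (z < (size (iota 0 m ++ [:: 0; 0; m; m])%N).+1)%N := ltn_ord z.
      by rewrite ltn_subLR // addSn ltnS -sz -ltnS.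
    by case: (z - _)%N => [|[|[|[|//]]]].
  rewrite size_cat size_iota nth_cat size_iota /= => im.
  case: ltnP => [lt|ge]; first by rewrite nth_iota.
  have : (i - m < 4)%N by lia.
  by case: (i - m)%N => [|[|[|[|//]]]].
- by move=> u v /and3P[].
- apply: support_tree_free => [f g [fi gi gf wf]|i].
    exact: (@has_euclidean_embedding _ _ EuclideanE6 f g).
  by case: i => [|[|[|[|[|[|]]]]]].
- apply: support_tree_free => [f g [fi gi gf wf]|i].
    exact: (@has_euclidean_embedding _ _ EuclideanE7 f g).
  by case: i => [|[|[|[|[|[|[|]]]]]]].
- apply: support_tree_free => [f g [fi gi gf wf]|i].
    exact: (@has_euclidean_embedding _ _ EuclideanE8 f g).
  by case: i => [|[|[|[|[|[|[|[|]]]]]]]].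
Qed.

End Critical.

(** * Positivity of the Tits form *)

Section MinimalCritical.
Variables (Q : quiver).
Implicit Types w d : dimension_vector Q.

(** The derivative of the product over the arrow a with respect to w_x; the sum
    over all arrows is the sum of w over the neighbours of x, counted with
    multiplicity. *)
Definition incidence w (a : arrow Q) x : nat :=
  ((target a == x) * w (source a) + (source a == x) * w (target a))%N.

Lemma lower_vertex w x : (0 < w x)%N -> (forall a : arrow Q, source a != target a) ->
  exists w' : dimension_vector Q, [/\ forall y, (w' y <= w y)%N,
    total_dim w = (total_dim w').+1,
    (\sum_y w' y * w' y + 2 * w x = \sum_y w y * w y + 1)%N
  & (\sum_a w' (target a) * w' (source a) + \sum_a incidence w a x
     = \sum_a w (target a) * w (source a))%N].
Proof.
move=> wx loopless; exists (fun y => w y - (y == x))%N; split.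
- by move=> y; rewrite leq_subr.
- rewrite /total_dim (bigD1 x) //= [in RHS](bigD1 x) //= eqxx -addSn subn1 prednK //.
  by congr (_ + _)%N; apply: eq_bigr => y /negPf->; rewrite subn0.
- rewrite (bigD1 x) //= [in RHS](bigD1 x) //= eqxx.
  rewrite (eq_bigr (fun y => w y * w y)%N) => [|y /negPf->]; last by rewrite subn0.
  by move: wx; case: (w x) => // n _; rewrite subn1 /=; lia.
- rewrite -big_split /=; apply: eq_bigr => a _; rewrite /incidence.
  have := loopless a; have [->|ta] := eqVneq (target a) x.
    by move=> /negPf->; rewrite subn0 subn1; case: (w x) wx => //= n _; lia.
  have [->|sa] := eqVneq (source a) x; last by rewrite !subn0; lia.
  by rewrite subn0 subn1; case: (w x) wx => //= n _; lia.
Qed.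

(** Euler's formula for the quadratic form defined by the arrows. *)
Lemma incidence_sum w :
  (\sum_x w x * \sum_a incidence w a x = 2 * \sum_a w (target a) * w (source a))%N.
Proof.
under eq_bigr do rewrite big_distrr /=.
rewrite exchange_big big_distrr /=; apply: eq_bigr => a _.
rewrite /incidence.
under eq_bigr do rewrite mulnDr.
rewrite big_split /= (bigD1 (target a)) //= eqxx big1 => [|y /negPf]; last first.
  by rewrite eq_sym => ->; rewrite muln0.
rewrite (bigD1 (source a)) //= eqxx big1 => [|y /negPf]; last first.
  by rewrite eq_sym => ->; rewrite muln0.
by rewrite !addn0; lia.
Qed.

Lemma incidence_neighbours w x : (forall a : arrow Q, source a != target a) ->
  ~ has_euclidean w -> (0 < w x)%N ->
  (\sum_a incidence w a x = \sum_(y | support_adj w x y) w y)%N.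
Proof.
move=> loopless noE wx.
have inc a : incidence w a x = (\sum_(y | joinsb a x y) w y)%N.
  rewrite /incidence; have [tx|ntx] := eqVneq (target a) x.
    have := loopless a; rewrite tx => /negPf sx; rewrite sx mul0n addn0 mul1n.
    rewrite (big_pred1 (source a)) // => y.
    by rewrite /joinsb tx sx eqxx andbT /= eq_sym.
  have [sx|nsx] := eqVneq (source a) x.
    rewrite mul0n mul1n add0n (big_pred1 (target a)) // => y.
    by rewrite /joinsb sx (negPf ntx) andbF orbF eqxx eq_sym.
  by rewrite !mul0n big_pred0 // => y; rewrite /joinsb (negPf ntx) (negPf nsx) andbF.
under eq_bigr do rewrite inc.
rewrite (exchange_big_dep predT) //= [RHS]big_mkcond /=; apply: eq_bigr => y _.
have [y0|wy] := posnP (w y).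
  by rewrite big1 => [|a _]; rewrite ?y0 //; case: ifP.
rewrite /support_adj wx wy !andbT; case: ifPn => [/existsP[a ja]|]; last first.
  by rewrite negb_exists => /forallP no; rewrite big_pred0 // => a; exact: negPf.
rewrite (big_pred1 a) // => b; apply/idP/eqP => [jb|-> //].
exact: joins_unique loopless noE _ _ _ _ wx wy jb ja.
Qed.

(** Let w be a minimal vector with S >= T, where S is the sum over the arrows
    and T the sum of squares.  Positivity after lowering one coordinate gives
    2 w_x + (S - T) <= N_x for x in the support, N_x being the sum of w over the
    neighbours.  Multiplying by w_x and summing gives
    2 T + (S - T) (sum of w) <= 2 S, hence S = T and equality for every x,
    unless the sum of w is at most 2; and then the inequality for one x is
    already absurd. *)
Theorem no_euclidean_tits_positive d : (forall a : arrow Q, source a != target a) ->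
  ~ has_euclidean d -> tits_positive_below d.
Proof.
move=> loopless noE w0 w0d w0_gt0; apply: contrapT => w0_crit.
pose crit w := [/\ forall x, (w x <= d x)%N, (0 < total_dim w)%N & ~ tits_positive w].
have [|w [wd w_gt0 /negP]] := @minimal_by _ crit (@total_dim Q).
  by exists w0.
rewrite /tits_positive -leqNgt => w_crit wmin.
have {}noE : ~ has_euclidean w.
  case=> S [h [he hw]]; apply: noE; exists S, h; split=> // x.
  exact: leq_trans (hw x) (wd _).
have inc x := incidence_neighbours (x := x) loopless noE.
have sumw x : (0 < w x)%N -> (total_dim w >= w x + \sum_a incidence w a x)%N.
  move=> wx; rewrite inc // /total_dim [X in (_ <= X)%N](bigD1 x) //= leq_add2l.
  rewrite [X in (_ <= X)%N](bigID (support_adj w x)) /=.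
  apply: leq_trans (leq_addr _ _); rewrite leq_eqVlt; apply/orP; left; apply/eqP.
  apply: eq_bigl => y; rewrite andbC andb_idr // => xy.
  by apply: contraTneq xy => ->; rewrite support_adj_irr.
set S := (\sum_a w (target a) * w (source a))%N in w_crit.
set T := (\sum_x w x * w x)%N in w_crit.
have step x : (0 < w x)%N -> (2 * w x + (S - T) <= \sum_a incidence w a x)%N.
  move=> wx; have [w' [w'w tot sq ar]] := lower_vertex wx loopless.
  have [w'0|w'_gt0] := posnP (total_dim w').
    have w'z y : w' y = 0%N.
      by move/eqP: w'0; rewrite /total_dim sum_nat_eq0 => /forallP/(_ y)/eqP.
    have := sumw x wx; move: sq ar; rewrite tot w'0 -/S -/T.
    rewrite big1 => [|y _]; last by rewrite w'z.
    rewrite big1 => [|a _]; last by rewrite w'z.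
    by move: w_crit; lia.
  have pos : tits_positive w'.
    apply: contrapT => crit'; have := wmin w'; rewrite tot ltnn => h.
    suff : false by []. apply: h; split=> // y; exact: leq_trans (w'w y) (wd y).
  move: pos; rewrite /tits_positive; rewrite -/S in ar; rewrite -/T in sq.
  by move: sq ar w_crit; lia.
have [x wx] : exists x, (0 < w x)%N.
  apply/existsP; apply: contraLR w_gt0; rewrite negb_exists => /forallP w0'.
  rewrite -leqNgt leqn0 /total_dim sum_nat_eq0; apply/forallP=> x /=.
  by have := w0' x; rewrite -leqNgt leqn0.
have le y : (w y * (2 * w y + (S - T)) <= w y * \sum_a incidence w a y)%N.
  by have [->//|wy] := posnP (w y); rewrite leq_mul2l step ?orbT.
have sum_le := leqif_sum (fun y (_ : true) => leqif_eq (le y)).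
have sumE : (\sum_y w y * (2 * w y + (S - T)) = 2 * T + total_dim w * (S - T))%N.
  rewrite /T /total_dim big_distrr big_distrl -big_split /=.
  by apply: eq_bigr => y _; lia.
move: sum_le; rewrite sumE incidence_sum -/S => sum_le.
have [ST|ST] := posnP (S - T)%N; last first.
  by have := (sum_le.1, sumw x wx, step x wx); case=> [[]]; nia.
apply: (support_not_harmonic loopless noE wx) => y wy.
have := sum_le.2; rewrite ST muln0 addn0.
have -> : S = T by lia.
rewrite eqxx => /esym/forallP/(_ y); rewrite /= addn0 eqn_pmul2l // inc //.
by move/eqP.
Qed.

End MinimalCritical.

(** * Polynomial maps from smaller affine spaces *)

Section PolynomialMaps.
Variable k : closedFieldType.

Lemma infinite_closed_field n : exists2 s : seq k, uniq s & size s = n.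
Proof.
elim: n => [|n [s us sn]]; first by exists [::].
have /closed_nonrootP[x] : \prod_(a <- s) ('X - a%:P) != 0.
  by rewrite monic_neq0 // monic_prod_XsubC.
by rewrite root_prod_XsubC => xs; exists (x :: s); rewrite /= ?xs ?us ?sn.
Qed.

(** Polynomial functions of one variable of degree at most n. *)
Definition degree_le n (f : k -> k) :=
  exists2 p : {poly k}, (size p <= n.+1)%N & forall s, f s = p.[s].

Lemma degree_le_const n c : degree_le n (fun=> c).
Proof.
exists c%:P => [|s]; last by rewrite hornerC.
by rewrite (leq_trans (size_polyC_leq1 c)).
Qed.

Lemma degree_le_id : degree_le 1 id.
Proof. by exists 'X => [|s]; rewrite ?size_polyX ?hornerX. Qed.

Lemma degree_le_add n f g : degree_le n f -> degree_le n g ->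
  degree_le n (fun s => f s + g s).
Proof.
move=> [p sp fp] [q sq gq]; exists (p + q) => [|s]; last by rewrite hornerD fp gq.
by rewrite (leq_trans (size_polyD _ _)) // geq_max sp sq.
Qed.

Lemma degree_le_mul m n f g : degree_le m f -> degree_le n g ->
  degree_le (m + n) (fun s => f s * g s).
Proof.
move=> [p sp fp] [q sq gq]; exists (p * q) => [|s]; last by rewrite hornerM fp gq.
by rewrite (leq_trans (size_polyMleq _ _)) //; lia.
Qed.

Lemma degree_le_sum n (X : Type) (r : seq X) (f : X -> k -> k) :
  (forall x, degree_le n (f x)) -> degree_le n (fun s => \sum_(x <- r) f x s).
Proof.
move=> hf; elim: r => [|x r IH].
  have [p sp hp] := degree_le_const n 0.
  by exists p => // s; rewrite big_nil -hp.
have [p sp hp] := degree_le_add (hf x) IH.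
by exists p => // s; rewrite big_cons -hp.
Qed.

Lemma degree_le_prod n (X : Type) (r : seq X) (f : X -> k -> k) :
  (forall x, degree_le n (f x)) ->
  degree_le (size r * n) (fun s => \prod_(x <- r) f x s).
Proof.
move=> hf; elim: r => [|x r IH].
  have [p sp hp] := degree_le_const 0 1.
  by exists p => // s; rewrite big_nil -hp.
have [p sp hp] := degree_le_mul (hf x) IH.
by exists p => // s; rewrite big_cons -hp.
Qed.

Lemma degree_le_eq0 n f (t : seq k) : degree_le n f -> uniq t -> (n < size t)%N ->
  (forall s, s \in t -> f s = 0) -> forall s, f s = 0.
Proof.
move=> [p sp fp] ut tn ft s; rewrite fp.
have [->|p0] := eqVneq p 0; first by rewrite horner0.
have := max_poly_roots p0 _ ut; rewrite leqNgt => /(_ _)/negP[].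
  by apply/allP=> x /ft; rewrite /root -fp => ->.
exact: leq_trans sp tn.
Qed.

Section Coordinates.
Variable I : finType.

Definition update (y : {ffun I -> k}) i s := [ffun j => if j == i then s else y j].

Definition degree_in_each n (F : {ffun I -> k} -> k) :=
  forall y i, degree_le n (fun s => F (update y i s)).

(** The degree bound concerns each variable separately, so the coordinates can
    be moved off the grid one at a time. *)
Lemma vanish_on_grid n F (t : seq k) : degree_in_each n F -> uniq t ->
  (n < size t)%N -> (forall y : {ffun I -> k}, (forall i, y i \in t) -> F y = 0) ->
  forall y, F y = 0.
Proof.
move=> dF ut tn Ft y; have [m] := ubnP #|[pred i | y i \notin t]|.
elim: m y => // m IH y /ltnSE ym.
have [[i yi]|allt] := pselect (exists i, y i \notin t); last first.
  by apply: Ft => i; apply: contrapT => /negP yi; apply: allt; exists i.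
have -> : y = update y i (y i) by apply/ffunP=> j; rewrite ffunE; case: eqP => // ->.
apply: (degree_le_eq0 (dF y i) ut tn) => s st; apply: IH.
apply: leq_trans ym; apply: proper_card; apply/properP; split.
  apply/fintype.subsetP=> j; rewrite !inE ffunE; case: eqP => [_|//].
  by rewrite st.
by exists i; rewrite !inE // ffunE eqxx st.
Qed.

End Coordinates.

Definition polynomial_on_lines (J : finType) (G : {ffun J -> k} -> k) :=
  forall a b : {ffun J -> k}, exists p : {poly k},
    forall s, G [ffun j => a j + s * (b j - a j)] = p.[s].

(** Join a nonzero of one function to a nonzero of the product of the others by
    a line: on it all of them are nonzero polynomials. *)
Lemma common_nonzero (J : finType) (X : Type) (r : seq X) (G : X -> {ffun J -> k} -> k) :
  (forall x, polynomial_on_lines (G x)) -> (forall x, exists y, G x y != 0) ->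
  exists y, \prod_(x <- r) G x y != 0.
Proof.
move=> Gl G0; elim: r => [|x r [a ra]].
  by exists [ffun=> 0]; rewrite big_nil oner_neq0.
have [b xb] := G0 x; have [p px] := Gl x a b.
have [q qr] : exists q : {poly k},
    forall s, \prod_(x <- r) G x [ffun j => a j + s * (b j - a j)] = q.[s].
  elim: r {ra} => [|z r [q qr]]; first by exists 1 => s; rewrite big_nil hornerE.
  have [pz pzE] := Gl z a b.
  by exists (pz * q) => s; rewrite big_cons qr pzE hornerM.
have a0 : [ffun j => a j + 0 * (b j - a j)] = a.
  by apply/ffunP=> j; rewrite ffunE mul0r addr0.
have b1 : [ffun j => a j + 1 * (b j - a j)] = b.
  by apply/ffunP=> j; rewrite ffunE mul1r addrC subrK.
have /closed_nonrootP[s] : p * q != 0.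
  rewrite mulf_neq0 //; first by apply: contraNneq xb => p0; rewrite -b1 px p0 horner0.
  by apply: contraNneq ra => q0; rewrite -[a]a0 qr q0 horner0.
rewrite /root hornerM => pq; exists [ffun j => a j + s * (b j - a j)].
by rewrite big_cons px qr.
Qed.

(** The coordinates of a polynomial map F into a space of larger dimension are
    algebraically dependent.  The Lagrange functions L on a grid with e points
    in each direction are e^|J| independent functions on the target, while
    a linear combination of their composites with F vanishes as soon as it does
    on a grid with E points in each direction, where E is a constant times e;
    for large e there are more functions than points.  Lagrange functions are
    preferable to monomials because their linear independence is seen by
    evaluation. *)
Lemma polynomial_relation (I J : finType) n (F : J -> {ffun I -> k} -> k) :
  (#|I| < #|J|)%N -> (forall j, degree_in_each n (F j)) ->
  exists G : {ffun J -> k} -> k, [/\ polynomial_on_lines G, exists x, G x != 0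
    & forall y, G [ffun j => F j y] = 0].
Proof.
move=> IJ dF.
(* E is at most C * e with C = n * |J| + 1, so e > C ^ |I| makes the number
   E ^ |I| of points smaller than e ^ (|I| + 1). *)
pose e := ((n * #|J|).+1 ^ #|I|).+1.
have [S uS sS] := infinite_closed_field e.
pose E := (#|J| * (e * n)).+1.
have [t ut st] := infinite_closed_field E.
pose l (a : 'I_e) (x : k) := \prod_(b <- enum 'I_e) (if b == a then 1 else x - S`_b).
pose L (a : {ffun J -> 'I_e}) (x : {ffun J -> k}) := \prod_(j <- enum J) l (a j) (x j).
pose A := \matrix_(a < #|{ffun J -> 'I_e}|, b < #|{ffun I -> 'I_E}|)
  L (enum_val a) [ffun j => F j [ffun i => t`_(enum_val b i)]].
have [c cA c0] : exists2 c : 'rV_#|{ffun J -> 'I_e}|, c *m A = 0 & c != 0.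
  have : kermx A != 0.
    rewrite kermx_eq0 /row_free neq_ltn; apply/orP; left.
    apply: leq_ltn_trans (rank_leq_col _) _.
    rewrite !card_ffun !card_ord.
    have E_le : (E <= (n * #|J|).+1 * e)%N by rewrite /E; nia.
    apply: leq_ltn_trans (_ : ((n * #|J|).+1 * e) ^ #|I| < _)%N.
      by case: (#|I|) => [//|i]; rewrite leq_exp2r.
    rewrite expnMn; apply: leq_trans (_ : e ^ #|I|.+1 <= _)%N.
      by rewrite expnS ltn_mul2r expn_gt0 /= ltnSn.
    by rewrite leq_exp2l // /e; lia.
  by case/rowV0Pn => c /sub_kermxP; exists c.
exists (fun x => \sum_a c 0 a * L (enum_val a) x); split.
- move=> x z.
  have lin a j : degree_le (#|'I_e| * 1) (fun s => l a (x j + s * (z j - x j))).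
    rewrite cardE; apply: degree_le_prod => b; case: (b == a); first exact: degree_le_const.
    exists ((x j - S`_b)%:P + (z j - x j) *: 'X) => [|s]; last first.
      by rewrite !hornerE addrAC mulrC.
    rewrite (leq_trans (size_polyD _ _)) // geq_max (leq_trans (size_polyC_leq1 _)) //.
    by rewrite (leq_trans (size_scale_leq _ _)) // size_polyX.
  have [|p _ hp] := @degree_le_sum (size (enum J) * (#|'I_e| * 1)) _
    (index_enum (Finite.clone 'I_#|{ffun J -> 'I_e}| _))
    (fun a s => c 0 a * L (enum_val a) [ffun j => x j + s * (z j - x j)]).
    move=> a; rewrite -[X in degree_le X]add0n; apply: degree_le_mul.
      exact: degree_le_const.
    have [q sq hq] := degree_le_prod (enum J) (fun j => lin (enum_val a j) j).
    exists q => // s; rewrite -hq; apply: eq_bigr => j _.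
    by rewrite ffunE.
  by exists p.
- have [a ca] : exists a, c 0 a != 0.
    apply/existsP; apply: contraNT c0; rewrite negb_exists => /forallP h.
    by apply/eqP/rowP=> i; rewrite mxE; apply/eqP/negPn.
  exists [ffun j => S`_(enum_val a j)].
  rewrite (bigD1 a) //= big1 => [|b ba]; last first.
    apply/eqP; rewrite mulf_eq0; apply/orP; right.
    have [j bj] : exists j, enum_val b j != enum_val a j.
      apply/existsP; apply: contraNT ba; rewrite negb_exists => /forallP h.
      by apply/eqP/enum_val_inj/ffunP=> j; apply/eqP/negPn.
    rewrite prodf_seq_eq0; apply/hasP; exists j; rewrite ?mem_enum //=.
    rewrite prodf_seq_eq0; apply/hasP; exists (enum_val a j); rewrite ?mem_enum //=.
    by rewrite (eq_sym (enum_val a j)) (negPf bj) ffunE subrr.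
  rewrite addr0 mulf_neq0 // prodf_seq_neq0; apply/allP=> j _ /=.
  rewrite prodf_seq_neq0; apply/allP=> b _ /=; rewrite ffunE.
  case: (eqVneq b (enum_val a j)) => [_|ba]; first exact: oner_neq0.
  by rewrite subr_eq0 nth_uniq ?sS // eq_sym.
- have dG : degree_in_each (size (enum J) * (#|'I_e| * n))
    (fun y => \sum_a c 0 a * L (enum_val a) [ffun j => F j y]).
    move=> y i; apply: degree_le_sum => a.
    rewrite -[X in degree_le X]add0n; apply: degree_le_mul.
      exact: degree_le_const.
    have [|q sq hq] := @degree_le_prod (#|'I_e| * n) _ (enum J)
      (fun j s => l (enum_val a j) (F j (update y i s))).
      move=> j; rewrite cardE; apply: degree_le_prod => b; case: (b == _).
        exact: degree_le_const.
      by apply: degree_le_add; [exact: dF|exact: degree_le_const].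
    exists q => // s; rewrite -hq; apply: eq_bigr => j _.
    by rewrite ffunE.
  apply: (vanish_on_grid dG ut) => [|y yt].
    by rewrite st /E -cardE card_ord.
  have yI i : exists m : 'I_E, t`_m = y i.
    have lt : (index (y i) t < E)%N by rewrite -st index_mem.
    by exists (Ordinal lt); rewrite /= nth_index.
  pose b : {ffun I -> 'I_E} := [ffun i => sval (cid (yI i))].
  have := congr1 (fun v : 'rV_ _ => v 0 (enum_rank b)) cA; rewrite !mxE => cA0.
  rewrite -[RHS]cA0; apply: eq_bigr => a _; rewrite mxE enum_rankK; congr (_ * L _ _).
  apply/ffunP=> j; rewrite !ffunE; congr (F j _); apply/ffunP=> i; rewrite !ffunE.
  by have := svalP (cid (yI i)).
Qed.

Theorem polynomial_maps_dont_cover (I J : finType) n (X : finType)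
    (F : X -> J -> {ffun I -> k} -> k) :
  (#|I| < #|J|)%N -> (forall x j, degree_in_each n (F x j)) ->
  exists z : {ffun J -> k}, forall x y, z <> [ffun j => F x j y].
Proof.
move=> IJ dF.
have /dependent_choice_fun[G hG] x := polynomial_relation IJ (dF x).
have [|x|z] := @common_nonzero J X (enum X) G.
- by move=> x; have [] := hG x.
- by have [] := hG x.
rewrite prodf_seq_neq0 => /allP zn; exists z => x y zE.
have [_ _ /(_ y)] := hG x; rewrite -zE => /eqP.
by apply/negP; apply: zn; rewrite mem_enum.
Qed.

End PolynomialMaps.

(** * Representatives of isomorphism classes *)

Lemma finite_range_family (T U : Type) (f : T -> U) (x0 : T) : finite_set (range f) ->
  exists n (g : 'I_n -> T), forall x, exists i, f x = f (g i).
Proof.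
move=> /(@finite_seqP {classic U})[s sE].
have inS x : f x \in (s : seq {classic U}).
  have : range f (f x) by exists x.
  by rewrite sE.
have /dependent_choice_fun[g gE] (i : 'I_(size s)) : exists x,
    nth (f x0 : {classic U}) s i = f x.
  have : range f (nth (f x0 : {classic U}) s i).
    by rewrite sE; apply: (mem_nth (f x0 : {classic U})).
  by case=> x _ <-; exists x.
exists (size s), g => x.
have lt : (index (f x : {classic U}) s < size s)%N by rewrite index_mem.
by exists (Ordinal lt); rewrite -gE /= nth_index.
Qed.

Lemma isomorphic_refl (k : fieldType) (Q : quiver) (d : dimension_vector Q)
  (M : representation k d) : isomorphic M M.
Proof.
apply/isomorphicP; exists (fun=> 1%:M), (fun=> 1%:M).
by split=> [x|a]; rewrite mulmx1 ?mul1mx.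
Qed.

Lemma isomorphism_class_eqP (k : fieldType) (Q : quiver) (d : dimension_vector Q)
  (M N : representation k d) :
  isomorphism_class M = isomorphism_class N <-> isomorphic M N.
Proof.
split=> [MN|MN].
  have : isomorphism_class N N by exact: isomorphic_refl.
  by rewrite -MN.
apply/seteqP; split=> L; rewrite /isomorphism_class /=.
  by apply: isomorphic_trans; exact: isomorphic_sym.
exact: isomorphic_trans.
Qed.

Lemma representatives (k : fieldType) (Q : quiver) (d : dimension_vector Q)
    (T : Type) (F : T -> representation k d) (t0 : T) :
  representation_finite k d ->
  exists n (g : 'I_n -> T), forall t, exists i, isomorphic (F (g i)) (F t).
Proof.
move=> fin.
have [|n [g gE]] := @finite_range_family T _ (fun t => isomorphism_class (F t)) t0.
  by apply: sub_finite_set fin => _ [t _ <-]; exists (F t).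
exists n, g => t; have [i ti] := gE t; exists i.
by apply/isomorphism_class_eqP.
Qed.

(** * Euclidean subquivers prevent finiteness *)

(** This is the equality of dimensions behind the parameter count: both sides
    are 4 m + 8 in type D. *)
Lemma euclidean_null (T : euclidean_type) :
  (\sum_x euclidean_weight (T := T) x * euclidean_weight (T := T) x
   = \sum_a euclidean_weight (T := T) (target a) * euclidean_weight (T := T) (source a))%N.
Proof.
case: T => [n|m|||].
- by rewrite /= !big_const !iter_addn !card_ord.
- rewrite /=.
  have -> : (\sum_(x < (size (iota 0 m ++ [:: 0; 0; m; m])%N).+1)
     (if (x <= m)%N then 2%N else 1%N) * (if (x <= m)%N then 2%N else 1%N)
     = 4 * m + 8)%N.
    rewrite -(big_mkord xpredT (fun x =>
      (if (x <= m)%N then 2%N else 1%N) * (if (x <= m)%N then 2%N else 1%N))%N).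
    rewrite size_cat size_iota /= addn4 (@big_cat_nat _ _ _ m.+1) //=; last by lia.
    rewrite (eq_big_nat _ _ (F2 := fun=> 4%N)) => [|i]; last by rewrite ltnS => /= ->.
    rewrite sum_nat_const_nat (eq_big_nat _ _ (F2 := fun=> 1%N)) => [|i /andP[mi _]].
      by rewrite sum_nat_const_nat; lia.
    by rewrite leqNgt mi.
  rewrite (eq_bigr (fun i : 'I_(size (iota 0 m ++ [:: 0; 0; m; m])%N) =>
    if (i < m)%N then 4%N else 2%N)) => [|i _]; last first.
    have sz : size (iota 0 m ++ [:: 0; 0; m; m])%N = (m + 4)%N by rewrite size_cat size_iota.
    have lei : (nth 0%N (iota 0 m ++ [:: 0; 0; m; m])%N i <= m)%N.
      rewrite nth_cat size_iota; case: ltnP => [im|mi]; first by rewrite nth_iota // ltnW.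
      by case: (i - m)%N => [|[|[|[|l]]]] //=; rewrite nth_nil.
    rewrite inordK; last first.
      by apply: leq_ltn_trans lei _; rewrite ltnS sz leq_addr.
    rewrite lei /= ?/bump ?leq0n ?add1n.
    by case: ifP.
  rewrite -(big_mkord xpredT (fun i => if (i < m)%N then 4%N else 2%N)).
  rewrite size_cat size_iota /= (@big_cat_nat _ _ _ m) //=; last by lia.
  rewrite (eq_big_nat _ _ (F2 := fun=> 4%N)) => [|i /= ->//].
  rewrite sum_nat_const_nat (eq_big_nat _ _ (F2 := fun=> 2%N)) => [|i /andP[mi _]].
    by rewrite sum_nat_const_nat; lia.
  by rewrite ltnNge mi.
- by rewrite !big_ord_recl !big_ord0 /= !inordK.
- by rewrite !big_ord_recl !big_ord0 /= !inordK.
- by rewrite !big_ord_recl !big_ord0 /= !inordK.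
Qed.

Lemma euclidean_weight1 (T : euclidean_type) :
  exists x, euclidean_weight (T := T) x = 1%N.
Proof.
case: T => [n|m|||].
- by exists ord0.
- have lt : (m.+1 < (size (iota 0 m ++ [:: 0; 0; m; m])%N).+1)%N.
    by rewrite size_cat size_iota /=; lia.
  by exists (Ordinal lt); rewrite /= ltnn.
- by exists (@Ordinal 7 2 isT).
- by exists (@Ordinal 8 3 isT).
- by exists (@Ordinal 9 5 isT).
Qed.

Section ExtensionByZero.
Variables (k : fieldType) (Q : quiver) (d : dimension_vector Q) (S : subquiver Q).
Variable h : dimension_vector S.
Hypothesis hd : forall x : vertex S, (h x <= d (val x))%N.

(** Extension by zero, along arrows outside S and, for arrows of S, from the
    first h_x coordinates to all of them. *)
Definition extend_rep (N : representation k h) : representation k d := fun a =>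
  match @idP (a \in sub_arrows S) with
  | ReflectT aS => let b : arrow S := Sub a aS in
     (pid_mx (h (target b)) : 'M_(d (target a), h (target b))) *m N b
     *m (pid_mx (h (source b)) : 'M_(h (source b), d (source a)))
  | ReflectF _ => 0
  end.

Lemma extend_repE N (b : arrow S) : extend_rep N (val b) =
  (pid_mx (h (target b)) : 'M_(d (target (val b)), h (target b))) *m N b
     *m (pid_mx (h (source b)) : 'M_(h (source b), d (source (val b)))).
Proof.
case: b => a aS; rewrite /extend_rep /=; case: {-}_ / idP => [aS'|//].
by rewrite (bool_irrelevance aS' aS).
Qed.

Lemma pid_mxK m n : (m <= n)%N ->
  (pid_mx m : 'M[k]_(m, n)) *m (pid_mx m : 'M_(n, m)) = 1%:M.
Proof. by move=> mn; rewrite mul_pid_mx minnn (minn_idPr mn) pid_mx_1. Qed.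

(** The diagonal blocks of an isomorphism between the extensions; they need not
    be invertible. *)
Lemma extend_rep_isomorphic (M N : representation k h) :
  isomorphic (extend_rep M) (extend_rep N) ->
  exists P P' : graded k h h,
    forall b, N b = P (target b) *m M b *m P' (source b).
Proof.
case=> g _ gE.
exists (fun x => (pid_mx (h x) : 'M_(h x, d (val x))) *m g (val x)
   *m (pid_mx (h x) : 'M_(d (val x), h x))).
exists (fun x => (pid_mx (h x) : 'M_(h x, d (val x))) *m invmx (g (val x))
   *m (pid_mx (h x) : 'M_(d (val x), h x))).
move=> b; have := gE (val b); rewrite !extend_repE => /(congr1 (fun Z =>
  (pid_mx (h (target b)) : 'M_(h (target b), d (target (val b)))) *m Z
  *m (pid_mx (h (source b)) : 'M_(d (source (val b)), h (source b))))).
rewrite !mulmxA pid_mxK ?hd // mul1mx -mulmxA pid_mxK ?hd // mulmx1 => ->.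
by rewrite -!mulmxA.
Qed.

End ExtensionByZero.

Section DimensionCount.
Variables (k : closedFieldType) (Q : quiver) (d : dimension_vector Q).
Variable color : vertex Q -> bool.
Hypothesis source_color : forall a : arrow Q, color (source a).
Hypothesis target_color : forall a : arrow Q, color (target a) = false.

(** When the vertices are sources or sinks, the base change at the sources may
    be replaced by its inverse, and the action becomes bilinear.  Let x0 be a
    vertex with h = 1.  Up to the scalars the block at x0 is 1 or 0, so each
    isomorphism class, restricted to the subquiver, is covered by two polynomial
    maps in the remaining parameters, one fewer than the coordinates of a
    representation. *)
Theorem representation_finite_no_euclidean :
  representation_finite k d -> ~ has_euclidean d.
Proof.
move=> fin [S [h [[T [f hf]] hd]]].
have null : (\sum_x h x * h x = \sum_a h (target a) * h (source a))%N.
  rewrite (eq_bigr (fun x => euclidean_weight (f x) * euclidean_weight (f x))%N); last first.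
    by move=> x _; rewrite hf.
  rewrite -(reindex (iso_vertex f) (P := xpredT)
    (F := fun x => euclidean_weight x * euclidean_weight x)%N); last first.
    exact: onW_bij (iso_vertex_bij f).
  rewrite euclidean_null (reindex (iso_arrow f)); last exact: onW_bij (iso_arrow_bij f).
  apply: eq_bigr => a _; rewrite !hf.
  by case: (iso_ends f a) => -[-> ->] //; rewrite mulnC.
have [x0 hx0] : exists x0, h x0 = 1%N.
  have [y wy] := euclidean_weight1 T; have [g _ gf] := iso_vertex_bij f.
  by exists (g y); rewrite hf gf.
have [n [R RE]] := @representatives k Q d _ (@extend_rep k Q d S h) (fun=> 0) fin.
pose E := {: entry h h}.
pose I := {z : E | tag z != x0}.
pose J := {: entry (fun a : arrow S => h (target a)) (fun a => h (source a))}.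
pose P (eps : bool) (y : {ffun I -> k}) x : 'M[k]_(h x) := \matrix_(i, j)
  if insub (Tagged (fun x => 'I_(h x) * 'I_(h x))%type (i, j)) is Some z
  then y z else eps%:R.
pose F (u : 'I_n * bool) (j : J) (y : {ffun I -> k}) :=
  (P u.2 y (target (tag j)) *m R u.1 (tag j) *m P u.2 y (source (tag j)))
    (tagged j).1 (tagged j).2.
have dP eps y i x p q : degree_le 1 (fun s => P eps (update y i s) x p q).
  have : degree_le 1 (fun s => if insub (Tagged (fun x => 'I_(h x) * 'I_(h x))%type (p, q))
     is Some z then update y i s z else eps%:R).
    case: insub => [z|]; last exact: degree_le_const.
    have [zi|zi] := eqVneq z i.
      by have [v sv hv] := degree_le_id k; exists v => // t; rewrite ffunE zi eqxx -hv.
    have [v sv hv] := degree_le_const 1 (y z).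
    by exists v => // t; rewrite ffunE (negPf zi) -hv.
  by case=> v sv hv; exists v => // t; rewrite mxE.
have h0 : (0 < h x0)%N by rewrite hx0.
have IJ : (#|{: I}| < #|J|)%N.
  rewrite card_entry -null -card_entry card_sig; apply: proper_card.
  apply/properP; split; first exact/fintype.subsetP.
  exists (Tagged (fun x => 'I_(h x) * 'I_(h x))%type (Ordinal h0, Ordinal h0)) => //.
  by rewrite !inE /= eqxx.
have [|z zF] := @polynomial_maps_dont_cover k {: I} J 2 {: 'I_n * bool} F IJ.
  move=> u [b [p q]] y i.
  have [|v sv hv] := @degree_le_sum k 2 _ (index_enum 'I_(h (source b)))
    (fun l s => (\sum_m P u.2 (update y i s) (target b) p m * R u.1 b m l)
       * P u.2 (update y i s) (source b) l q).
    move=> l; apply: (@degree_le_mul k 1 1) => //.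
    apply: degree_le_sum => m; rewrite -[1%N]addn0.
    by apply: degree_le_mul; [apply: dP|apply: degree_le_const].
  exists v => // s; rewrite -hv /F /= mxE; apply: eq_bigr => l _.
  by rewrite [X in X * _]mxE.
pose N : representation k h := fun a => \matrix_(p, q)
  z (Tagged (fun a => 'I_(h (target a)) * 'I_(h (source a)))%type (p, q)).
have [i /extend_rep_isomorphic[//|P0 [P0' NE]]] := RE N.
have [P1 [eps [P1E P1x0]]] : exists (P1 : graded k h h) (eps : bool),
    (forall b, N b = P1 (target b) *m R i b *m P1 (source b)) /\
    forall p q, P1 x0 p q = eps%:R.
  have cs (b : arrow S) : color (val (source b)) = true := source_color (val b).
  have ct (b : arrow S) : color (val (target b)) = false := target_color (val b).
  pose P2 (x : vertex S) := if color (val x) then P0' x else P0 x.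
  have P2E b : N b = P2 (target b) *m R i b *m P2 (source b).
    by rewrite NE /P2 cs ct.
  have o_uniq (p : 'I_(h x0)) : p = Ordinal h0.
    by apply: val_inj; case: p => p /= lt; move: lt; rewrite hx0 ltnS leqn0 => /eqP.
  have [c0|c0] := eqVneq (P2 x0 (Ordinal h0) (Ordinal h0)) 0.
    by exists P2, false; split=> // p q; rewrite (o_uniq p) (o_uniq q).
  (* Rescale by c at the vertices of one colour and by its inverse at the others. *)
  set c := P2 x0 _ _ in c0.
  pose s (x : vertex S) := if color (val x) == color (val x0) then c^-1 else c.
  exists (fun x => s x *: P2 x), true; split=> [b|p q]; last first.
    by rewrite mxE /s eqxx (o_uniq p) (o_uniq q) mulVf.
  rewrite -!scalemxAl -scalemxAr scalerA P2E -[LHS]scale1r; congr (_ *: _).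
  rewrite /s cs ct.
  by case: (color _); rewrite /= ?mulVf ?mulfV.
pose y : {ffun I -> k} := [ffun u => P1 (tag (val u)) (tagged (val u)).1 (tagged (val u)).2].
have PE x : P eps y x = P1 x.
  apply/matrixP=> p q; rewrite mxE; case: insubP => [u _ uE|].
    by rewrite ffunE uE.
  by move=> /negPn/eqP/= xx0; move: p q; rewrite xx0 => p q; rewrite P1x0.
apply: (zF (i, eps) y); apply/ffunP=> j; rewrite ffunE /F /= !PE -P1E mxE.
by case: j => a [p q].
Qed.

End DimensionCount.

(** * Orbits in the algebra *)

Section Algebra.
Variables (k : closedFieldType) (A : falgType k).
Hypothesis rad2 : rad_square_zero A.
Variable D : wedderburn_data A.

Local Notation pi := (@block_proj k A D).
Local Notation e := (@block_idem k A D).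
Local Notation n := (@block_size k A D).
Local Notation Q := (associated_quiver D).
Local Notation w := (@associated_dimension k A D).

Implicit Types a b r s u v : A.

Lemma radicalP r : jacobson_radical r <-> forall i, pi i r = 0.
Proof. exact: iff_sym (block_proj_ker D r). Qed.

Lemma projM i a b : pi i (a * b) = pi i a *m pi i b.
Proof. exact: rmorphM. Qed.

Lemma proj1 i : pi i 1 = 1%:M.
Proof. exact: rmorph1. Qed.

Lemma radical_mul r s : jacobson_radical r -> jacobson_radical s -> r * s = 0.
Proof. exact: rad2. Qed.

Lemma radicalMr a r : jacobson_radical r -> jacobson_radical (r * a).
Proof. by move=> /radicalP r0; apply/radicalP => i; rewrite projM r0 mul0mx. Qed.

Lemma unit_proj a i : a \is a GRing.unit -> pi i a \in unitmx.
Proof.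
by move=> ua; have [] := @mulmx1_unit _ _ (pi i a) (pi i a^-1); rewrite // -projM divrr // proj1.
Qed.

Lemma proj_inv a i : a \is a GRing.unit -> pi i a^-1 = invmx (pi i a).
Proof.
move=> ua; have ui := unit_proj i ua.
by rewrite -[LHS]mul1mx -(mulVmx ui) -mulmxA -projM divrr // proj1 mulmx1.
Qed.

(** An element invertible modulo an ideal of square zero is invertible. *)
Lemma proj_unit a : (forall i, pi i a \in unitmx) -> a \is a GRing.unit.
Proof.
move=> ua; have [b bE] := @block_proj_surj k A D (fun i => invmx (pi i a)).
have rl : jacobson_radical (1 - b * a).
  by apply/radicalP=> i; rewrite raddfB /= projM proj1 bE (mulVmx (ua i)) subrr.
have rr : jacobson_radical (1 - a * b).
  by apply/radicalP=> i; rewrite raddfB /= projM proj1 bE (mulmxV (ua i)) subrr.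
have inv r : jacobson_radical r -> (1 + r) * (1 - r) = 1 /\ (1 - r) * (1 + r) = 1.
  move=> hr; rewrite !mulrDr !mulrDl !mul1r !mulr1 mulrN mulNr (radical_mul hr hr).
  by rewrite oppr0 !addr0 subrK addrK.
have lE : (1 + (1 - b * a)) * (b * a) = 1.
  by have := (inv _ rl).1; rewrite subKr.
have rE : (a * b) * (1 + (1 - a * b)) = 1.
  by have := (inv _ rr).2; rewrite subKr.
apply/unitrP; exists (b * (1 + (1 - a * b))).
have E : (1 + (1 - b * a)) * b = b * (1 + (1 - a * b)).
  transitivity ((1 + (1 - b * a)) * b * ((a * b) * (1 + (1 - a * b)))).
    by rewrite rE mulr1.
  by rewrite !mulrA -(mulrA _ b a) lE mul1r.
by rewrite mulrA rE -E -mulrA lE.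
Qed.

(** The e_i need not be orthogonal in A, but their sum is 1 modulo the radical
    and therefore acts as 1 on it. *)
Lemma radical_peirce r : jacobson_radical r -> r = \sum_i \sum_j e i * r * e j.
Proof.
move=> hr; pose s := \sum_i e i.
have hs : jacobson_radical (1 - s).
  apply/radicalP=> j; rewrite raddfB /= proj1 raddf_sum /= (bigD1 j) //=.
  rewrite block_idem_lift eqxx big1 ?addr0 ?subrr // => i ij.
  by rewrite block_idem_lift (negPf ij).
have sr : s * r = r.
  by have /eqP := radical_mul hs hr; rewrite mulrBl mul1r subr_eq0 => /eqP.
have rs : r * s = r.
  by have /eqP := radical_mul hr hs; rewrite mulrBr mulr1 subr_eq0 => /eqP.
rewrite -{1}sr -{1}rs mulrA /s mulr_suml mulr_suml.
by apply: eq_bigr => i _; rewrite mulr_sumr.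
Qed.

Definition block_iso i j := sval (cid (@block_rankP k A D i j)).

Lemma block_iso_inj i j : injective (block_iso i j).
Proof. by have [] := svalP (cid (@block_rankP k A D i j)). Qed.

Lemma block_iso_range i j :
  range (block_iso i j) = [set e i * x * e j | x in @jacobson_radical A].
Proof. by have [] := svalP (cid (@block_rankP k A D i j)). Qed.

Lemma block_isoM i j a b X : a * block_iso i j X * b =
  block_iso i j [ffun m => pi i a *m X m *m pi j b].
Proof. by have [_ _ ->] := svalP (cid (@block_rankP k A D i j)). Qed.

Definition block_of (M : representation k w) i j :
    {ffun 'I_(@block_rank k A D i j) -> 'M[k]_(n i, n j)} :=
  [ffun m => M (existT (fun ij : 'I_(blocks D) * 'I_(blocks D) => 'I_(@block_rank k A D ij.1 ij.2))
     (i, j) m)].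

(** The identification of the representations of dimension vector w with the
    radical; by radical_ofM multiplication by elements of A acts on the matrices
    through A / rad A. *)
Definition radical_of (M : representation k w) : A :=
  \sum_i \sum_j block_iso i j (block_of M i j).

Lemma radical_of_peirce M i j :
  e i * radical_of M * e j = block_iso i j (block_of M i j).
Proof.
rewrite /radical_of mulr_sumr mulr_suml (bigD1 i) //=.
rewrite [X in _ + X]big1 ?addr0 => [|i' ii']; last first.
  rewrite mulr_sumr mulr_suml big1 // => j' _; rewrite block_isoM.
  rewrite (_ : [ffun m => _] = 0) ?raddf0 //; apply/ffunP=> m.
  by rewrite !ffunE block_idem_lift eq_sym (negPf ii') !mul0mx.
rewrite mulr_sumr mulr_suml (bigD1 j) //= [X in _ + X]big1 ?addr0 => [|j' jj']; last first.
  rewrite block_isoM (_ : [ffun m => _] = 0) ?raddf0 //; apply/ffunP=> m.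
  by rewrite !ffunE block_idem_lift [X in _ *m X]block_idem_lift eq_sym (negPf jj') mulmx0.
rewrite block_isoM; congr (block_iso _ _ _); apply/ffunP=> m.
by rewrite !ffunE !block_idem_lift !eqxx mul1mx mulmx1.
Qed.

Lemma radical_of_inj M N : radical_of M = radical_of N -> forall c : arrow Q, M c = N c.
Proof.
move=> MN [[i j] m].
have := radical_of_peirce M i j; rewrite MN radical_of_peirce => /block_iso_inj.
by move=> /ffunP/(_ m); rewrite !ffunE => ->.
Qed.

Lemma radical_of_surj r : jacobson_radical r -> exists M, radical_of M = r.
Proof.
move=> hr.
have X i j : exists X, block_iso i j X = e i * r * e j.
  have : range (block_iso i j) (e i * r * e j) by rewrite block_iso_range; exists r.
  by case=> x _ <-; exists x.
pose M : representation k w := fun c => sval (cid (X (tag c).1 (tag c).2)) (tagged c).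
exists M; rewrite [RHS]radical_peirce //; apply: eq_bigr => i _; apply: eq_bigr => j _.
rewrite -(svalP (cid (X i j))); congr (block_iso _ _ _).
by apply/ffunP=> m; rewrite ffunE.
Qed.

Lemma radical_ofM M u v : u * radical_of M * v =
  radical_of (fun c => pi (tag c).1 u *m M c *m pi (tag c).2 v).
Proof.
rewrite /radical_of mulr_sumr mulr_suml; apply: eq_bigr => i _.
rewrite mulr_sumr mulr_suml; apply: eq_bigr => j _.
by rewrite block_isoM; congr (block_iso _ _ _); apply/ffunP=> m; rewrite !ffunE.
Qed.

Lemma eq_radical_of M N : (forall c : arrow Q, M c = N c) -> radical_of M = radical_of N.
Proof.
move=> MN; apply: eq_bigr => i _; apply: eq_bigr => j _; congr (block_iso _ _ _).
by apply/ffunP=> m; rewrite !ffunE MN.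
Qed.

Lemma unit_orbit_eq (a b u v : A) : u \is a GRing.unit -> v \is a GRing.unit ->
  b = u * a * v -> unit_orbit a = unit_orbit b.
Proof.
move=> uu uv ->; apply/seteqP; split=> c [u' [v' [uu' uv' ->]]].
  exists (u' * u^-1), (v' * v); split; rewrite ?unitrMr ?unitrV //.
  by rewrite invrM // !mulrA mulrVK // mulrK.
exists (u' * u), (v' * v^-1); split; rewrite ?unitrMr ?unitrV //.
by rewrite invrM ?unitrV // invrK !mulrA.
Qed.

(** For elements of the radical, lying in one orbit means that the
    representations are isomorphic: the unit on the left acts at the vertices
    (0, i) and the one on the right at the vertices (1, j). *)
Lemma finite_orbits_representation_finite :
  finitely_many_unit_orbits A -> representation_finite k w.
Proof.
move=> fin.
have [|m [g gE]] := @finite_range_family (representation k w) _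
    (fun M => unit_orbit (radical_of M)) (fun=> 0).
  by apply: sub_finite_set fin => _ [M _ <-]; exists (radical_of M).
apply: (@sub_finite_set _ _ (range (fun i => isomorphism_class (g i)))); last first.
  by apply: finite_image; exact: finite_finset.
move=> _ [M _ <-]; have [i Mi] := gE M; exists i => //.
apply/isomorphism_class_eqP.
have : unit_orbit (radical_of M) (radical_of M).
  by exists 1, 1; split; rewrite ?unitr1 // mul1r divr1.
rewrite Mi => -[u [v [uu uv]]]; rewrite radical_ofM => /radical_of_inj ME.
exists (fun x : bool * 'I_(blocks D) => if x.1 then pi x.2 v else pi x.2 u).
  by case=> [[] x] /=; apply: unit_proj.
by move=> a; rewrite ME proj_inv.
Qed.

(** The polynomial 3 X^2 - 2 X^3 is idempotent modulo (X^2 - X)^2 and congruent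
    to X modulo X^2 - X. *)
Lemma idempotent_lift (x : A) : jacobson_radical (x * x - x) ->
  exists2 c : A, c * c = c & jacobson_radical (c - x).
Proof.
move=> hx; pose h : {rmorphism {poly k} -> A} := horner_alg x.
pose p : {poly k} := 'X * 'X * (3%:R - 2%:R * 'X).
have hX : h 'X = x by exact: horner_algX.
have hr : h ('X * 'X - 'X) = x * x - x by rewrite rmorphB rmorphM hX.
exists (h p).
  apply/eqP; rewrite -subr_eq0 -rmorphM -rmorphB /=.
  have -> : p * p - p = ('X * 'X - 'X) * ('X * 'X - 'X)
      * (4%:R * ('X * 'X) - 4%:R * 'X - 3%:R) by rewrite /p; ring.
  by rewrite 2!rmorphM hr (radical_mul hx hx) mul0r.
have -> : h p - x = h (p - 'X) by rewrite rmorphB hX.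
have -> : p - 'X = ('X * 'X - 'X) * (1 - 2%:R * 'X) by rewrite /p; ring.
by rewrite rmorphM hr; apply: radicalMr.
Qed.

Lemma radical_unit r : jacobson_radical r -> 1 - r \is a GRing.unit.
Proof.
move=> /radicalP hr; apply: proj_unit => i.
by rewrite raddfB /= hr subr0 proj1 unitmx1.
Qed.

(** Row and column operations with coefficients in the radical leave only the
    corner of r complementary to c. *)
Lemma clear_radical (c r : A) : jacobson_radical r ->
  (1 - r) * (c + r) * (1 - r * (1 - c)) = c + (1 - c) * r * (1 - c).
Proof.
move=> hr; have hs : jacobson_radical (r * (1 - c)) by apply: radicalMr.
have -> : (1 - r) * (c + r) = c + r * (1 - c).
  rewrite mulrBl mul1r mulrDr (radical_mul hr hr) addr0.
  by rewrite mulrBr mulr1 addrA.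
rewrite -(mulrA (1 - c)); move: (r * (1 - c)) hs => s hs.
rewrite mulrBr mulr1 mulrDl (radical_mul hs hs) addr0 mulrBl mul1r.
by rewrite addrA.
Qed.

Lemma pid_mx_idem m (p : nat) :
  (pid_mx p : 'M[k]_m) *m (pid_mx p : 'M[k]_m) = pid_mx p.
Proof. by rewrite mul_pid_mx minnn pid_mx_minv. Qed.

(** Let c be an idempotent lift of the partial identities.  After
    clear_radical, a is c + r with r in the corner of 1 - c, that is, r comes
    from a representation N of the dimension vector d of the complementary
    blocks.  The base change relating N to one of the chosen representatives N0
    lifts to units u with u c = c u = c. *)
Lemma corner_finite (p : 'I_(blocks D) -> nat) :
  (forall d : dimension_vector Q, (forall x, d x <= w x)%N ->
     finitely_represented (fun M : representation k d => True)) ->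
  exists B : set A, finite_set B /\
  forall a, (forall i, pi i a = pid_mx (p i)) -> exists2 b, B b & unit_orbit a = unit_orbit b.
Proof.
move=> fin.
have [x xE] := @block_proj_surj k A D (fun i => pid_mx (p i)).
have [|c cc /radicalP cx] := @idempotent_lift x.
  by apply/radicalP => i; rewrite raddfB /= projM xE pid_mx_idem subrr.
have cE i : pi i c = pid_mx (p i).
  by have /eqP := cx i; rewrite raddfB /= subr_eq0 xE => /eqP.
have /dependent_choice_fun[EF EFP] (y : vertex Q) :
    exists EF : {r & 'M[k]_(w y, r) * 'M[k]_(r, w y)}%type,
    (tagged EF).2 *m (tagged EF).1 = 1%:M /\
    (tagged EF).1 *m (tagged EF).2 = 1%:M - pid_mx (p y.2).
  have [|r [E [F h]]] := @split_idempotent k _ (1%:M - pid_mx (p y.2) : 'M_(w y)).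
    by rewrite mulmxBr mulmx1 mulmxBl mul1mx pid_mx_idem subrr subr0.
  by exists (existT _ r (E, F)).
pose d : dimension_vector Q := fun y => tag (EF y).
pose E y : 'M[k]_(w y, d y) := (tagged (EF y)).1.
pose F y : 'M[k]_(d y, w y) := (tagged (EF y)).2.
have FE y : F y *m E y = 1%:M by have [] := EFP y.
have EFE y : E y *m F y = 1%:M - pid_mx (p y.2) by have [] := EFP y.
have PE y : (pid_mx (p y.2) : 'M_(w y)) *m E y = 0.
  have -> : pid_mx (p y.2) = 1%:M - E y *m F y :> 'M_(w y) by rewrite EFE subKr.
  by rewrite mulmxBl mul1mx -mulmxA FE mulmx1 subrr.
have FP y : F y *m (pid_mx (p y.2) : 'M_(w y)) = 0.
  have -> : pid_mx (p y.2) = 1%:M - E y *m F y :> 'M_(w y) by rewrite EFE subKr.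
  by rewrite mulmxBr mulmx1 mulmxA FE mul1mx subrr.
clearbody E F.
have [|S finS hS] := fin d; first by move=> y; exact: mulmx1_leq (FE y).
pose enlarge (N : representation k d) : representation k w :=
  fun al => E (target al) *m N al *m F (source al).
exists [set c + radical_of (enlarge N) | N in S]; split; first exact: finite_image.
move=> a aE; pose r := a - c.
have hr : jacobson_radical r by apply/radicalP=> i; rewrite raddfB /= aE cE subrr.
have [M ME] := radical_of_surj hr.
pose N : representation k d := fun al => F (target al) *m M al *m E (source al).
have [N0 SN0 [g gu gE]] := hS N I.
exists (c + radical_of (enlarge N0)); first by exists N0.
have c1 i : pi i (1 - c) = 1%:M - pid_mx (p i) by rewrite raddfB /= proj1 cE.
have aN : (1 - r) * a * (1 - r * (1 - c)) = c + radical_of (enlarge N).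
  have -> : a = c + r by rewrite addrC subrK.
  rewrite clear_radical // -{1}ME radical_ofM; congr (_ + _).
  apply: eq_radical_of => al; rewrite !c1 /enlarge /N.
  by rewrite -(EFE (target al)) -(EFE (source al)) !mulmxA.
rewrite (unit_orbit_eq (radical_unit hr) (radical_unit (radicalMr _ hr)) (esym aN)).
(* Adding c to a lift inside the corner of 1 - c makes it fix c exactly, and not
   only modulo the radical. *)
have lift_unit (b : bool) (q : forall y, 'M[k]_(d y)) : (forall y, q y \in unitmx) ->
    exists u : A, [/\ u \is a GRing.unit, u * c = c, c * u = c
      & forall i, pi i u = pid_mx (p i) + E (b, i) *m q (b, i) *m F (b, i)].
  move=> qu; have [z zE] := @block_proj_surj k A D (fun i => E (b, i) *m q (b, i) *m F (b, i)).
  pose u := c + (1 - c) * z * (1 - c).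
  have uE i : pi i u = pid_mx (p i) + E (b, i) *m q (b, i) *m F (b, i).
    rewrite raddfD /= 2!projM c1 cE zE -(EFE (b, i)) !mulmxA.
    rewrite -(mulmxA (E (b, i)) (F (b, i)) (E (b, i))) FE mulmx1.
    by rewrite -(mulmxA _ (F (b, i)) (E (b, i))) FE mulmx1.
  exists u; split=> //.
  - apply: proj_unit => i; rewrite uE.
    have [] // := @mulmx1_unit _ _ (pid_mx (p i) + E (b, i) *m q (b, i) *m F (b, i))
      (pid_mx (p i) + E (b, i) *m invmx (q (b, i)) *m F (b, i)).
    rewrite mulmxDl !mulmxDr pid_mx_idem !mulmxA (PE (b, i)) !mul0mx addr0.
    rewrite -(mulmxA _ (F (b, i)) (pid_mx _)) (FP (b, i)) mulmx0 add0r.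
    rewrite -(mulmxA _ (F (b, i)) (E (b, i))) FE mulmx1.
    by rewrite mulmxK // EFE addrC subrK.
  - have oc : (1 - c) * c = 0 by rewrite mulrBl mul1r cc subrr.
    by rewrite /u mulrDl cc -(mulrA _ (1 - c) c) oc mulr0 addr0.
  - have co : c * (1 - c) = 0 by rewrite mulrBr mulr1 cc subrr.
    by rewrite /u mulrDr cc !mulrA co !mul0r addr0.
have [u [uu uc cu uE]] := lift_unit false g gu.
have [|v [uv vc cv vE]] := lift_unit true (fun y => invmx (g y)).
  by move=> y; rewrite unitmx_inv.
symmetry; apply: (unit_orbit_eq uu uv).
rewrite mulrDr mulrDl uc cv radical_ofM; congr (_ + _).
apply: eq_radical_of => al; rewrite /enlarge gE.
have uT : pi (tag al).1 u *m E (target al) = E (target al) *m g (target al).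
  rewrite uE mulmxDl (PE (target al)) add0r.
  by rewrite -(mulmxA _ (F (target al)) (E (target al))) FE mulmx1.
have vS : F (source al) *m pi (tag al).2 v = invmx (g (source al)) *m F (source al).
  by rewrite vE mulmxDr (FP (source al)) add0r !mulmxA (FE (source al)) mul1mx.
by rewrite !mulmxA uT -(mulmxA _ (F (source al)) (pi _ v)) vS !mulmxA.
Qed.

(** Gaussian elimination in each component of A / rad A brings any element to
    one of finitely many partial identities. *)
Lemma finite_representations_finite_orbits :
  (forall d : dimension_vector Q, (forall x, d x <= w x)%N ->
     finitely_represented (fun M : representation k d => True)) ->
  finitely_many_unit_orbits A.
Proof.
move=> fin.
pose I := {ffun 'I_(blocks D) -> 'I_(\sum_i n i).+1}.
have /dependent_choice_fun[B BP] (p : I) := corner_finite (fun i => p i : nat) fin.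
apply: (@sub_finite_set _ _ [set unit_orbit b | b in \bigcup_p B p]); last first.
  apply: finite_image; apply: bigcup_finite => [|p _]; last by have [] := BP p.
  exact: finite_finset.
move=> _ [a _ <-].
have [u uE] := @block_proj_surj k A D (fun i => invmx (col_ebase (pi i a))).
have [v vE] := @block_proj_surj k A D (fun i => invmx (row_ebase (pi i a))).
have uu : u \is a GRing.unit.
  by apply: proj_unit => i; rewrite uE unitmx_inv col_ebase_unit.
have uv : v \is a GRing.unit.
  by apply: proj_unit => i; rewrite vE unitmx_inv row_ebase_unit.
have lt i : (\rank (pi i a) < (\sum_i n i).+1)%N.
  rewrite ltnS (leq_trans (rank_leq_row _)) // (bigD1 i) //=.
  exact: leq_addr.
have [|b Bb e] := (BP [ffun i => Ordinal (lt i)]).2 (u * a * v).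
  move=> i; rewrite 2!projM uE vE ffunE /= -{2}(mulmx_ebase (pi i a)).
  by rewrite !mulmxA mulVmx ?col_ebase_unit // mul1mx mulmxK ?row_ebase_unit.
exists b; first by exists [ffun i => Ordinal (lt i)].
by rewrite -e; apply: esym; apply: (unit_orbit_eq uu uv).
Qed.

End Algebra.

Theorem proposition6 (k : closedFieldType) (A : falgType k)
    (hA : rad_square_zero A) (D : wedderburn_data A) :
  (finitely_many_unit_orbits A <->
     representation_finite k (@associated_dimension k A D)) /\
  (finitely_many_unit_orbits A <->
     ~ exists (Q : subquiver (associated_quiver D)) (h : dimension_vector Q),
         euclidean_with h /\
         forall x : vertex Q, (h x <= associated_dimension (val x))%N).
Proof.
have orbits_rep := @finite_orbits_representation_finite k A D.
have rep_euclidean : representation_finite k (@associated_dimension k A D) ->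
    ~ has_euclidean (@associated_dimension k A D).
  exact: (@representation_finite_no_euclidean k (associated_quiver D) _
    (fun x : bool * 'I_(blocks D) => x.1) (fun=> isT) (fun=> erefl)).
have euclidean_orbits : ~ has_euclidean (@associated_dimension k A D) ->
    finitely_many_unit_orbits A.
  move=> noE; apply: (finite_representations_finite_orbits hA).
  apply: tits_positive_finite; apply: (no_euclidean_tits_positive _ noE) => a.
  exact/eqP.
by split; split; auto.
Qed.
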